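(* Let $\alpha\in(0,1)$. Assume that $0<\beta\le 1$. Let $L>0$, $L_0<L$, $\gamma\in(0,1)$, and let $f_0\in H(\beta,L_0)$ be a probability density on $\mathcal X$. Set $z_\alpha=e^{2\alpha}-e^{-2\alpha}$ and $C_0(B)=\min\{f_0(x):x\in B\}$. For all compact sets $B\subset\mathbb R$ (with $B\subset\mathcal X$) we get $$\mathcal E_{n,\alpha}(f_0,\gamma)\ge C(\gamma,L,L_0)\min\Big\{|B|\,C_0(B),\ |B|^{\frac{\beta+1}{2\beta+1}}(nz_\alpha^2)^{-\frac{\beta}{2\beta+1}}\Big\}.$$ If, moreover, $B$ satisfies $$|B|^{\beta/(2\beta+1)}C_0(B)\ge C(nz_\alpha^2)^{-\beta/(2\beta+1)}$$ for some $C>0$, it holds $$\mathcal E_{n,\alpha}(f_0,\gamma)\ge C(\gamma,L,L_0)\,|B|^{\frac{\beta+1}{2\beta+1}}(nz_\alpha^2)^{-\frac{\beta}{2\beta+1}}.$$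
   Context: **Model.** $\mathcal X\subset\mathbb R$; $X_1,\dots,X_n$ are i.i.d. with probability density $f:\mathcal X\to\mathbb R_+$. For $0<\beta\le1$ and $L>0$, $H(\beta,L)=\{f:\mathcal X\to\mathbb R_+: |f(x)-f(y)|\le L|x-y|^\beta\ \forall x,y\in\mathcal X\}$. One tests $H_0: f\equiv f_0$ against $H_1(\rho)$: $f$ is a probability density in $H(\beta,L)$ with $\|f-f_0\|_1\ge\rho$, where $\rho>0$. $|B|$ denotes the Lebesgue measure of $B$. **Privacy.** A sequentially interactive mechanism $Q$ is a sequence of Markov kernels $Q_1,\dots,Q_n$ producing private data in a space $\mathcal Z$ by $Z_i\sim Q_i(\cdot\mid X_i=x_i,Z_1=z_1,\dots,Z_{i-1}=z_{i-1})$. It is $\alpha$-locally differentially private if $Q_i(A\mid X_i=x,Z_1=z_1,\dots,Z_{i-1}=z_{i-1})\le e^\alpha Q_i(A\mid X_i=x',Z_1=z_1,\dots,Z_{i-1}=z_{i-1})$ for all $i$, all measurable $A$, all $x,x'\in\mathcal X$ and all $z_1,\dots,z_{i-1}\in\mathcal Z$. $\mathcal Q_\alpha$ is the set of these mechanisms, $\Phi_Q$ the set of $\{0,1\}$-valued tests based on $Z_1,\dots,Z_n$, and $\mathbb P_{Q_f^n}$ the law of $(Z_1,\dots,Z_n)$ when the $X_i$ have density $f$. **Testing risk and radius.** $$\mathcal R_{n,\alpha}(f_0,\rho)=\inf_{Q\in\mathcal Q_\alpha}\inf_{\phi\in\Phi_Q}\sup_{f\in H_1(\rho)}\{\mathbb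 P_{Q_{f_0}^n}(\phi=1)+\mathbb P_{Q_f^n}(\phi=0)\},\qquad \mathcal E_{n,\alpha}(f_0,\gamma)=\inf\{\rho>0:\mathcal R_{n,\alpha}(f_0,\rho)\le\gamma\}.$$ **Constants.** $C(\gamma,L,L_0)$ denotes a positive constant depending on $\gamma,L,L_0$; its value may differ from one occurrence to another.
   Formalization: The constants C(γ,L,L0) may also depend on the fixed sample space 𝒳 and, in the second bound, on the constant C of its hypothesis; constants depending on γ, L, L0 alone are impossible (𝒳=B=[0,ε] with ε→0; respectively nz_α²→0). 𝒳 is taken Borel. *)

(* Defs.v *)
From HB Require Import structures.
From mathcomp Require Import all_boot all_order all_algebra.
From mathcomp Require Import all_classical all_reals all_analysis.
From mathcomp Require Import measurable_realfun.

Set Implicit Arguments.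
Unset Strict Implicit.
Unset Printing Implicit Defensive.

Import Order.TTheory GRing.Theory Num.Theory.
Import numFieldNormedType.Exports.

Local Open Scope classical_set_scope.
Local Open Scope ring_scope.

(* A function on X is represented by a total function R -> R; every notion
   below only looks at its values on X. *)

Definition prob_density (R : realType) (X : set R) (f : R -> R) : Prop :=
  [/\ measurable_fun X f,
      forall x, X x -> 0 <= f x
    & (\int[lebesgue_measure]_(x in X) (f x)%:E = 1)%E].

Definition holder_class (R : realType) (X : set R) (beta L : R) :
    set (R -> R) :=
  [set f | (forall x, X x -> 0 <= f x) /\
           forall x y, X x -> X y -> `|f x - f y| <= L * `|x - y| `^ beta].

Definition L1_dist (R : realType) (X : set R) (f g : R -> R) : \bar R :=
  (\int[lebesgue_measure]_(x in X) `|f x - g x|%:E)%E.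

Definition alternatives (R : realType) (X : set R) (beta L : R)
    (f0 : R -> R) (rho : R) : set (R -> R) :=
  [set f | [/\ prob_density X f, holder_class X beta L f
             & (rho%:E <= L1_dist X f f0)%E]].

(* [Q i (x, z)] is the law of Z_(i+1) given X_(i+1) = x and
   (Z_1, ..., Z_i) = z.  With n observations only the kernels of index i < n
   matter.  The kernels are defined for all x in R; only x in X matters. *)
Definition mechanism (R : realType) (d : measure_display)
    (Z : measurableType d) : Type :=
  forall i : nat, R.-pker (R * i.-tuple Z)%type ~> Z.

Definition ldp (R : realType) (d : measure_display) (Z : measurableType d)
    (X : set R) (n : nat) (alpha : R) : set (mechanism R Z) :=
  [set Q : mechanism R Z |
    forall (i : nat) (A : set Z) (x x' : R) (z : i.-tuple Z),
      (i < n)%N -> measurable A -> X x -> X x' ->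
      (Q i (x, z) A <= (expR alpha)%:E * Q i (x', z) A)%E].

(* The law of (Z_1, ..., Z_n) when X_1, ..., X_n are i.i.d. with density f
   on X, by successive disintegration: Z_1, ..., Z_i depend on
   X_1, ..., X_i only, so X_(i+1) is independent of them. *)
Fixpoint private_law (R : realType) (d : measure_display)
    (Z : measurableType d) (X : set R) (Q : mechanism R Z) (f : R -> R)
    (n : nat) : set (n.-tuple Z) -> \bar R :=
  match n with
  | 0 => dirac [tuple]
  | i.+1 => fun A =>
      (\int[private_law X Q f (n := i)]_z
       \int[lebesgue_measure]_(x in X)
         ((f x)%:E * Q i (x, z) [set z' | A [tuple of rcons z z']]))%E
  end.

Lemma measurable_rcons d (T : measurableType d) n :
  measurable_fun [set: n.-tuple T * T]
    (fun p : n.-tuple T * T => [tuple of rcons p.1 p.2] : n.+1.-tuple T).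
Proof.
apply/measurable_fun_tnthP => i.
have [lin|nli] := ltnP i n.
  rewrite (_ : _ \o _ = (fun p : n.-tuple T * T => tnth p.1 (Ordinal lin))).
    apply: (measurableT_comp (measurable_tnth (Ordinal lin))) => //.
  apply/funext => -[z t] /=.
  by rewrite !(tnth_nth t)/= nth_rcons size_tuple lin.
rewrite (_ : _ \o _ = snd) //.
apply/funext => -[z t] /=.
have ein : (i : nat) = n by apply/eqP; rewrite eqn_leq nli andbT -ltnS.
by rewrite !(tnth_nth t)/= nth_rcons size_tuple ein ltnn eqxx.
Qed.

Section private_law_probability.
Context (R : realType) (d : measure_display) (Z : measurableType d).
Context (X : set R) (mX : measurable X) (Q : mechanism R Z) (f : R -> R).
Context (df : prob_density X f).
Local Open Scope ereal_scope.

Let f0 x : X x -> (0 <= f x)%R. Proof. by case: df => _ + _; exact. Qed.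

Let sec n (A : set (n.+1.-tuple Z)) (z : n.-tuple Z) : set Z :=
  [set z' | A [tuple of rcons z z']].

Let msec n (A : set (n.+1.-tuple Z)) z : measurable A -> measurable (sec A z).
Proof.
move=> mA; rewrite /sec -[X in measurable X]setTI.
have := measurableT_comp (@measurable_rcons _ Z n)
  (pair1_measurable z).
by move/(_ measurableT _ mA).
Qed.

Let mQ n (A : set (n.+1.-tuple Z)) : measurable A ->
  measurable_fun [set: n.-tuple Z * R]
    (fun p : n.-tuple Z * R => ((f \_ X) p.2)%:E * Q n (p.2, p.1) (sec A p.1)).
Proof.
move=> mA; apply: emeasurable_funM.
  apply/measurable_EFinP; apply: measurableT_comp => //.
  by apply/(measurable_restrictT _ _).1 => //; case: df.
pose h := fun q : (R * n.-tuple Z) * Z =>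
  (\1_A ([tuple of rcons q.1.2 q.2] : n.+1.-tuple Z))%:E : \bar R.
have mh : measurable_fun [set: R * n.-tuple Z] (kfcomp (Q n) h).
  apply: measurable_kfcomp; last by move=> t; rewrite lee_fin.
  apply/measurable_EFinP; apply: measurableT_comp => //.
  have mp : measurable_fun [set: (R * n.-tuple Z) * Z]
      (fun q : (R * n.-tuple Z) * Z => (q.1.2, q.2)).
    apply/measurable_fun_pairP; split.
      exact: (measurableT_comp measurable_snd measurable_fst).
    exact: measurable_snd.
  exact: (measurableT_comp (@measurable_rcons _ Z n) mp).
have -> : (fun p : n.-tuple Z * R => Q n (p.2, p.1) (sec A p.1)) =
  kfcomp (Q n) h \o (fun p => (p.2, p.1)).
  apply/funext => -[z x] /=; rewrite /kfcomp /h.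
  have -> : (fun y => (\1_A ([tuple of rcons z y] : n.+1.-tuple Z))%:E) =
      (fun y => (\1_(sec A z) y)%:E) :> (Z -> \bar R).
    by apply/funext => y; rewrite !indicE; congr (_%:R%:E).
  by rewrite integral_indic ?setIT//; exact: msec.
apply: measurableT_comp => //.
apply/measurable_fun_pairP; split; [exact: measurable_snd|exact: measurable_fst].
Qed.

Lemma private_law_probability n :
  exists P : probability (n.-tuple Z) R,
    (P : set _ -> \bar R) = private_law X Q f (n := n).
Proof.
elim: n => [|n [P eP]]; first by exists (dirac [tuple]).
pose I A z := \int[lebesgue_measure]_(x in X)
  ((f x)%:E * Q n (x, z) (sec A z)).
have eI A z : I A z = fubini_F lebesgue_measure
    (fun p : n.-tuple Z * R => ((f \_ X) p.2)%:E * Q n (p.2, p.1) (sec A p.1)) z.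
  rewrite /I integral_mkcond /fubini_F; apply: eq_integral => x _.
  by rewrite !patchE/=; case: ifP => //; rewrite mul0e.
have mI A : measurable A -> measurable_fun setT (I A).
  move=> mA; rewrite (funext (eI A)); apply: measurable_fun_fubini_tonelli_F.
    exact: mQ.
  move=> [z x]/=; rewrite patchE; case: ifPn => [|_]; last by rewrite mul0e.
  by rewrite inE => Xx; rewrite mule_ge0// lee_fin f0.
have I0 A z : 0 <= I A z.
  by apply: integral_ge0 => x Xx; rewrite mule_ge0// lee_fin f0.
pose mu A := \int[P]_z I A z.
have emu : mu = private_law X Q f (n := n.+1) by rewrite /mu eP.
have mu0 : mu set0 = 0.
  apply: integral0_eq => z _; apply: integral0_eq => x _.
  by rewrite (_ : sec _ _ = set0) ?measure0 ?mule0// -subset0.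
have mu_ge0 A : 0 <= mu A by apply: integral_ge0 => z _.
have mfQ A z : measurable A ->
    measurable_fun X (fun x => (f x)%:E * Q n (x, z) (sec A z)).
  move=> mA; apply: emeasurable_funM.
    by apply/measurable_EFinP; case: df.
  apply: measurable_funTS.
  apply: (measurableT_comp (measurable_kernel (Q n) _ (msec z mA))).
  by apply/measurable_fun_pairP; split; [exact: measurable_id|exact: measurable_cst].
have mu_add : semi_sigma_additive mu.
  move=> F mF tF mUF.
  rewrite (_ : mu _ = \sum_(i <oo) mu (F i)).
    by apply: is_cvg_nneseries => i _ _; exact: mu_ge0.
  rewrite /mu -integral_nneseries//; last by move=> i; exact: mI.
  apply: eq_integral => z _.
  rewrite /I -integral_nneseries//; last 2 first.
    by move=> i; exact: mfQ.
    by move=> i x Xx; rewrite mule_ge0// lee_fin f0.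
  apply: eq_integral => x /[!inE] Xx.
  rewrite nneseriesZl//; congr (_ * _).
  rewrite (_ : sec _ _ = \bigcup_i sec (F i) z)//.
  have ts : trivIset setT (fun i => sec (F i) z).
    apply/trivIsetP => i j _ _ ij.
    have /trivIsetP/(_ i j Logic.I Logic.I ij) FF := tF.
    rewrite -subset0 => t [a b].
    have : (F i `&` F j) [tuple of rcons z t] by split.
    by rewrite FF.
  apply/esym/cvg_lim => //; apply: measure_semi_sigma_additive => //.
    by move=> i; exact: msec.
  by apply: bigcup_measurable => i _; exact: msec.
have mu1 : mu setT = 1.
  rewrite /mu (eq_integral (cst 1)).
    rewrite integral_cst// mul1e; exact: probability_setT.
  move=> z _; case: (df) => _ _ <-; apply: eq_integral => x _.
  by rewrite (_ : sec _ _ = setT) ?prob_kernel ?mule1//.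
pose M1 := isMeasure.Build _ _ R mu mu0 mu_ge0 mu_add.
pose M : {measure set (n.+1.-tuple Z) -> \bar R} := HB.pack mu M1.
pose P1 := Measure_isProbability.Build _ _ R M mu1.
pose PP : probability (n.+1.-tuple Z) R := HB.pack mu M1 P1.
by exists PP; rewrite -emu.
Qed.
End private_law_probability.

(* The supremum over an empty set of alternatives is -oo, so the risk is then
   at most gamma, as it would be with the convention that it is 0. *)
Definition testing_risk (R : realType) (d : measure_display)
    (Z : measurableType d) (X : set R) (beta L : R) (n : nat) (alpha : R)
    (f0 : R -> R) (rho : R) : \bar R :=
  ereal_inf [set
    ereal_inf [set
      ereal_sup [set
        (private_law X Q f0 (phi @^-1` [set true]) +
         private_law X Q f (phi @^-1` [set false]))%E
      | f in alternatives X beta L f0 rho]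
    | phi in [set: {mfun n.-tuple Z >-> bool}]]
  | Q in @ldp R d Z X n alpha].

Definition testing_radius (R : realType) (d : measure_display)
    (Z : measurableType d) (X : set R) (beta L : R) (n : nat) (alpha : R)
    (f0 : R -> R) (gamma : R) : \bar R :=
  ereal_inf [set rho%:E | rho in [set rho : R | 0 < rho /\
    (testing_risk Z X beta L n alpha f0 rho <= gamma%:E)%E]].

Definition z_alpha (R : realType) (alpha : R) : R :=
  expR (2 * alpha) - expR (- (2 * alpha)).

Definition vol (R : realType) (B : set R) : R := fine (lebesgue_measure B).

(* A minimum whenever B is compact and nonempty and f0 is Hoelder on B, see
   [min_on_attained]. *)
Definition min_on (R : realType) (f0 : R -> R) (B : set R) : R :=
  inf (f0 @` B).

Lemma min_on_attained (R : realType) (beta L : R) (f0 : R -> R) (X B : set R) :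
  0 < beta -> holder_class X beta L f0 -> compact B -> B !=set0 -> B `<=` X ->
  exists2 c, B c & f0 c = min_on f0 B /\ forall x, B x -> f0 c <= f0 x.
Proof.
move=> b0 [f00 H] cB B0 BX.
have L0 (x y : R) : X x -> X y -> `|f0 x - f0 y| <= (`|L| + 1) * `|x - y| `^ beta.
  move=> Xx Xy; apply: le_trans (H _ _ Xx Xy) _.
  by rewrite ler_wpM2r ?powR_ge0// (le_trans (ler_norm _)) // lerDl.
have cf : {within B, continuous f0}.
  apply/subspace_continuousP => x Bx.
  apply/cvgrPdist_lt => e e0.
  have d0 : 0 < (e / (`|L| + 1)) `^ beta^-1.
    by rewrite powR_gt0// divr_gt0// ltr_wpDl.
  near=> y.
  have yB : B y by near: y; apply: withinT; exact: nbhs_filter.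
  apply: (le_lt_trans (L0 _ _ (BX _ Bx) (BX _ yB))).
  rewrite -ltr_pdivlMl ?ltr_wpDl// mulrC.
  have -> : e / (`|L| + 1) = ((e / (`|L| + 1)) `^ beta^-1) `^ beta.
    by rewrite -powRrM mulVf ?gt_eqF// powRr1// divr_ge0// ltW// ltr_wpDl.
  rewrite gt0_ltr_powR// ?nnegrE ?powR_ge0//.
  near: y; apply: cvg_within; exact: (nbhsx_ballx x _ d0).
have [c cB' mc] := compact_EVT_min B0 cB cf.
rewrite inE in cB'; exists c => //; split; last first.
  by move=> x Bx; apply: mc; rewrite inE.
apply/eqP; rewrite eq_le; apply/andP; split.
  apply: lb_le_inf; first by exists (f0 c); exists c.
  by move=> _ [x Bx <-]; apply: mc; rewrite inE.
apply: ge_inf; last by exists c.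
by exists (f0 c) => _ [x Bx <-]; apply: mc; rewrite inE.
Unshelve. all: by end_near. Qed.

(* Main.v *)
Require Import Defs.
From HB Require Import structures.
From mathcomp Require Import all_boot all_order all_algebra.
From mathcomp Require Import all_classical all_reals all_analysis.
From mathcomp Require Import measurable_realfun.
From mathcomp Require Import ring lra.

Set Implicit Arguments.
Unset Strict Implicit.
Unset Printing Implicit Defensive.

Import Order.TTheory GRing.Theory Num.Theory.
Import numFieldNormedType.Exports.

Local Open Scope classical_set_scope.
Local Open Scope ring_scope.

(** Write M = |B|, W = n z_alpha^2, and let h be the bin width solving
    h^(2 beta + 1) M W = 1.  The second term of the minimum is then M h^beta.
    It is enough that, for rho below a small multiple of
    min (M C_0) (M h^beta), every private test has error sum above gamma
    against some alternative at distance rho.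

    The alternatives.  Suppose M > 2 h.  Cut B into 2 N cells of equal mass
    m = M / (2 N), with N between M / (2 h) and M / h [equal_mass_cells].  In a
    cell with ends s and t take the bump min (f0, tent^beta), where tent is the
    distance to the complement of the cell.  It is beta-Hoelder because f0 is,
    it lies below f0 however X looks between the points of B, and its mass is
    at least (m / 2) min (C_0, (m / 4)^beta) [bump_mass].  Rescale all bumps to
    a common mass and let psi_j be the difference of two of them, times a small
    eps.  Then the functions f0 + sum_j (+- psi_j) are densities in H(beta, L)
    at distance at least rho from f0 [perturbed_density_alternative].

    If M <= 2 h, two cells of mass h would exhaust B.  Information is then so
    scarce that a single alternative (1 - rho) f0 + rho g suffices.  Here g is
    one of two Lipschitz densities with disjoint supports which depend on X
    only; one of them is at distance at least 1 from f0 [separated_far].  The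
    constant of the theorem depends on X through them.

    Why a private test cannot see them.  Fix the past outputs.  Privacy makes
    the mean of v(Z) nearly independent of the input x, and since psi_j has
    integral zero, R_j(v) = int psi_j(x) E[v(Z) | x] dx satisfies
    |R_j(v)| <= kappa_j E|v(Z)| under f0, with
    kappa_j = (e^alpha - 1) |psi_j|_1 [output_mean_contrast].

    Let P be the law of the outputs under f0 and Q_w their law under the w-th
    alternative.  Given an event A, let v_i be the conditional Q_w-probability
    of A after i outputs.  The quantity followed along the interaction is
    E_P [v_i - lambda v_i^2].  In one step the strict concavity of the potential
    pays lambda times the mean square deviation of v_i, while passing from Q_w
    to P costs sum_j e_j(w) R_j(v), with e_j(w) the signs.  The functions v
    depend on w, but after averaging over w the cost only sees their
    coefficients on the orthonormal family e_j, and Bessel's inequality bounds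
    the squares of these by the deviation already paid for.  What remains is
    sum_j kappa_j^2 / (4 lambda) per step [one_step_bound].  Over n steps
    P(A) exceeds the average of Q_w(A) by at most
    lambda + n sum_j kappa_j^2 / (4 lambda) [quadratic_potential], and
    n sum_j kappa_j^2 <= W rho^2 / N is a small constant as soon as
    rho <= c M h^beta.

    Under the additional hypothesis on B, the first term of the minimum is at
    least C times the second, which gives the second bound. *)

(** * Mixtures of measures and the law of the private sample *)

Section mixture.
Context d d' (Y : measurableType d) (T : measurableType d') (R : realType).
Variables (nu : {measure set Y -> \bar R}) (m : {measure set T -> \bar R}).
Variable k : Y -> {measure set T -> \bar R}.
Hypothesis mk : forall A, measurable A -> measurable_fun setT (k ^~ A).
Hypothesis mE : forall A, measurable A -> m A = (\int[nu]_y k y A)%E.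
Local Open Scope ereal_scope.
Import HBNNSimple.

Let integral_mixture_nnsfun (h : {nnsfun T >-> R}) :
  \int[m]_t (h t)%:E = \int[nu]_y \int[k y]_t (h t)%:E.
Proof.
under [RHS]eq_integral do rewrite integralT_nnsfun sintegralE.
rewrite integralT_nnsfun sintegralE.
have mh r : measurable (h @^-1` [set r]) by exact: measurable_funPTI.
rewrite ge0_integral_fsum//=.
- apply: eq_fsbigr => r /[!inE] -[t _ <-].
  by rewrite mE// ge0_integralZl ?lee_fin//; exact: mk.
- by move=> r; exact: measurable_funeM (mk (mh r)).
- move=> r y _; have [[t ht]|nr] := pselect (exists t, h t = r).
    by rewrite mule_ge0// lee_fin -ht.
  rewrite (_ : h @^-1` _ = set0) ?measure0 ?mule0//.
  by rewrite -subset0 => t ht; apply: nr; exists t.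
Qed.

(** A mixture of measures integrates functions as it integrates events: pass
    from indicators to simple functions, then to monotone limits. *)
Lemma integral_mixture (f : T -> \bar R) :
  (forall t, 0 <= f t) -> measurable_fun setT f ->
  \int[m]_t f t = \int[nu]_y \int[k y]_t f t.
Proof.
move=> f0 mf; pose h := nnsfun_approx measurableT mf.
have mh n : measurable_fun setT (EFin \o h n) by exact/measurable_EFinP.
have ndh t : {homo (fun n => (h n t)%:E) : a b / (a <= b)%N >-> a <= b}.
  by move=> a b ab; rewrite lee_fin; exact/lefP/nd_nnsfun_approx.
have fE (mu : {measure set T -> \bar R}) :
    \int[mu]_t f t = limn (fun n => \int[mu]_t (h n t)%:E).
  rewrite -monotone_convergence//; last by move=> n t _; rewrite lee_fin.
  by apply: eq_integral => t _; apply/esym/cvg_lim => //;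
    exact: cvg_nnsfun_approx.
rewrite fE; under [RHS]eq_integral do rewrite fE.
rewrite monotone_convergence//=.
- by congr (limn _); apply/funext => N; exact: integral_mixture_nnsfun.
- move=> N; apply: measurable_fun_integral_kernel => //.
    by move=> t; rewrite lee_fin.
  exact: mh.
- by move=> n y _; apply: integral_ge0 => t _; rewrite lee_fin.
- move=> y _ a b ab; apply: ge0_le_integral => //.
  + by move=> t _; rewrite lee_fin.
  + exact: mh.
  + exact: mh.
  + by move=> t _; exact: ndh.
Qed.

End mixture.

(** The law of (Z_1, ..., Z_(n+1)) is defined on events.  This section extends
    the successive disintegration to integrals, and provides the measurability
    in the past outputs that makes the induction on the sample size possible. *)
Section disintegration.
Context (R : realType) (d : measure_display) (Z : measurableType d).
Context (X : set R) (mX : measurable X) (Q : mechanism R Z) (f : R -> R).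
Context (df : prob_density X f) (n : nat).
Implicit Types v : n.+1.-tuple Z -> R.
Local Open Scope ereal_scope.

Let integrand v (p : n.-tuple Z * R) := ((f \_ X) p.2)%:E *
  \int[Q n (p.2, p.1)]_z' (v [tuple of rcons p.1 z'])%:E.

Let fX0 x : (0 <= (f \_ X) x)%R.
Proof.
rewrite patchE; case: ifPn => //; rewrite inE => Xx.
by case: df => _ + _; exact.
Qed.

Let measurable_rcons1 (z : n.-tuple Z) :
  measurable_fun [set: Z] (fun z' => [tuple of rcons z z'] : n.+1.-tuple Z).
Proof. exact: measurableT_comp (@measurable_rcons _ Z n)
    (pair1_measurable z). Qed.

Let measurable_swap :
  measurable_fun [set: n.-tuple Z * R] (fun p => (p.2, p.1)).
Proof. by apply/measurable_fun_pairP; split;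
  [exact: measurable_snd|exact: measurable_fst]. Qed.

Let measurable_integrand v : measurable_fun setT v ->
    (forall t, (0 <= v t)%R) ->
  measurable_fun setT (integrand v).
Proof.
move=> mv v0; apply: emeasurable_funM.
  apply/measurable_EFinP; apply: measurableT_comp => //.
  by apply/(measurable_restrictT _ _).1 => //; case: df.
pose h (q : (R * n.-tuple Z) * Z) := (v [tuple of rcons q.1.2 q.2])%:E.
have -> : (fun p : n.-tuple Z * R =>
      \int[Q n (p.2, p.1)]_z' (v [tuple of rcons p.1 z'])%:E) =
    kfcomp (Q n) h \o (fun p => (p.2, p.1)).
  by apply/funext => -[z x]; rewrite /kfcomp /h.
apply: measurableT_comp; last exact: measurable_swap.
apply: measurable_kfcomp; last by move=> t; rewrite lee_fin.
apply/measurable_EFinP; apply: measurableT_comp => //.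
have mp : measurable_fun [set: (R * n.-tuple Z) * Z]
    (fun q : (R * n.-tuple Z) * Z => (q.1.2, q.2)).
  apply/measurable_fun_pairP; split.
    exact: (measurableT_comp measurable_snd measurable_fst).
  exact: measurable_snd.
exact: (measurableT_comp (@measurable_rcons _ Z n) mp).
Qed.

Let integrand_ge0 v p : (forall t, (0 <= v t)%R) -> 0 <= integrand v p.
Proof.
move=> v0; rewrite mule_ge0 ?lee_fin//.
by apply: integral_ge0 => z' _; rewrite lee_fin.
Qed.

(** Extending the integrand by zero outside X turns the inner integral into a
    section of a function on a product space, where Tonelli applies. *)
Let stepE v z :
  \int[lebesgue_measure]_(x in X) ((f x)%:E *
    \int[Q n (x, z)]_z' (v [tuple of rcons z z'])%:E) =
  fubini_F lebesgue_measure (integrand v) z.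
Proof.
rewrite integral_mkcond; apply: eq_integral => x _.
by rewrite !patchE/= /integrand /= patchE; case: ifP => //; rewrite mul0e.
Qed.

Lemma measurable_private_step v :
  measurable_fun setT v -> (forall t, (0 <= v t)%R) ->
  measurable_fun setT (fun z : n.-tuple Z =>
  \int[lebesgue_measure]_(x in X) ((f x)%:E *
    \int[Q n (x, z)]_z' (v [tuple of rcons z z'])%:E)).
Proof.
move=> mv v0; rewrite (funext (stepE v)).
apply: measurable_fun_fubini_tonelli_F; first exact: measurable_integrand.
by move=> p; exact: integrand_ge0.
Qed.

(** Tonelli presents the law of n + 1 outputs as one mixture over the pair made
    of the past z and the input x: the component at (z, x) is f(x) times the
    image of Q(x, z) under z' |-> (z, z'). *)
Lemma integral_private_law (P : probability (n.-tuple Z) R)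
    (P' : probability (n.+1.-tuple Z) R) v :
  (P : set _ -> \bar R) = private_law X Q f (n := n) ->
  (P' : set _ -> \bar R) = private_law X Q f (n := n.+1) ->
  measurable_fun setT v -> (forall t, (0 <= v t)%R) ->
  \int[P']_t (v t)%:E =
  \int[P]_z \int[lebesgue_measure]_(x in X) ((f x)%:E *
    \int[Q n (x, z)]_z' (v [tuple of rcons z z'])%:E).
Proof.
move=> eP eP' mv v0.
pose push (p : n.-tuple Z * R) : {measure set (n.+1.-tuple Z) -> \bar R} :=
  measure_function_pushforward__canonical__measure_function_Measure
    (Q n (p.2, p.1)) (measurable_rcons1 p.1).
pose k (p : n.-tuple Z * R) : {measure set (n.+1.-tuple Z) -> \bar R} :=
  mscale (NngNum (fX0 p.2)) (push p).
have kE A p : measurable A -> k p A = integrand \1_A p.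
  move=> mA; rewrite /k /= /mscale/=; congr (_ * _).
  rewrite /pushforward -(setIT (_ @^-1` _)) -integral_indic//.
  by rewrite -(setTI (_ @^-1` _)); exact: measurable_rcons1.
under [RHS]eq_integral do rewrite stepE.
rewrite -fubini_tonelli1//; last 2 first.
- exact: measurable_integrand.
- by move=> p; exact: integrand_ge0.
rewrite (@integral_mixture _ _ _ _ _ (P \x lebesgue_measure) _ k)//.
- apply: eq_integral => p _; rewrite ge0_integral_mscale//=; last 2 first.
    exact/measurable_EFinP.
    by move=> t _; rewrite lee_fin.
  congr (_ * _); rewrite ge0_integral_pushforward//.
  exact/measurable_EFinP.
  by move=> t _; rewrite lee_fin.
- move=> A mA; under eq_fun do rewrite kE//.
  by apply: measurable_integrand => // t; rewrite indicE.
- move=> A mA; under eq_integral do rewrite kE//.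
  rewrite fubini_tonelli1//; last 2 first.
  - by apply: measurable_integrand => // t; rewrite indicE.
  - by move=> p; apply: integrand_ge0 => t; rewrite indicE.
  transitivity ((P' : set _ -> \bar R) A) => //.
  rewrite eP' /= -eP; apply: eq_integral => z _; rewrite -stepE.
  apply: eq_integral => x _; congr (_ * _).
  rewrite integral_indic ?setIT//.
  by have := @measurable_rcons1 z measurableT _ mA; rewrite setTI.
- exact/measurable_EFinP.
Qed.
End disintegration.

(** * Orthonormal families and bounded functions *)

(** Expand the square of N x - sum_j c_j e_j, where c_j is the unnormalised
    coefficient of x and N = |Om|. *)
Lemma bessel (R : realFieldType) (Om J : finType) (e : J -> Om -> R)
    (x : Om -> R) :
  (forall j k, \sum_w e j w * e k w = (j == k)%:R * #|Om|%:R) ->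
  \sum_j (\sum_w e j w * x w) ^+ 2 <= #|Om|%:R * \sum_w x w ^+ 2.
Proof.
move=> orth; set N : R := #|Om|%:R.
have [N0|N0] := eqVneq #|Om| 0%N.
  have no (w : Om) : False by have := card0_eq N0 w.
  rewrite [leLHS]big1 ?mulr_ge0 ?ler0n ?sumr_ge0// => j _.
  by rewrite big1 ?expr0n// => w; case: (no w).
have Npos : 0 < N by rewrite ltr0n lt0n.
set c := fun j => \sum_w e j w * x w.
have sq : \sum_w (\sum_j c j * e j w) ^+ 2 = N * \sum_j c j ^+ 2.
  under eq_bigr => w _.
    rewrite expr2 mulr_suml; under eq_bigr do rewrite mulr_sumr.
    over.
  rewrite exchange_big mulr_sumr; apply: eq_bigr => j _ /=.
  rewrite exchange_big (bigD1 j)//= [X in _ + X]big1 ?addr0; last first.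
    move=> k kj; rewrite (eq_bigr (fun w => (c j * c k) * (e j w * e k w))).
      by rewrite -mulr_sumr orth eq_sym (negbTE kj) mul0r mulr0.
    by move=> w _; ring.
  rewrite (eq_bigr (fun w => c j ^+ 2 * (e j w * e j w))).
    by rewrite -mulr_sumr orth eqxx mul1r mulrC.
  by move=> w _; ring.
have cross : \sum_w x w * (\sum_j c j * e j w) = \sum_j c j ^+ 2.
  under eq_bigr do rewrite mulr_sumr.
  rewrite exchange_big; apply: eq_bigr => j _ /=.
  by rewrite expr2 {3}/c mulr_sumr; apply: eq_bigr => w _; ring.
have : 0 <= \sum_w (N * x w - \sum_j c j * e j w) ^+ 2.
  by apply: sumr_ge0 => w _; exact: sqr_ge0.
rewrite (eq_bigr (fun w => N ^+ 2 * x w ^+ 2 +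
    (- (2 * N) * (x w * (\sum_j c j * e j w)) +
     (\sum_j c j * e j w) ^+ 2))); last by move=> w _; ring.
rewrite !big_split/= -!mulr_sumr sq cross.
rewrite (_ : _ + _ = N * (N * (\sum_w x w ^+ 2) - \sum_j c j ^+ 2));
  last by ring.
by rewrite pmulr_rge0// subr_ge0.
Qed.

Section bounded_functions.
Context d (T : measurableType d) (R : realType).
Implicit Types u v : T -> R.

Definition bounded_mf v := measurable_fun setT v /\
    exists M : R, forall t, `|v t| <= M.

Lemma bounded_mf_cst (c : R) : bounded_mf (fun=> c).
Proof. by split => //; exists `|c|. Qed.

Lemma bounded_mfD u v : bounded_mf u -> bounded_mf v ->
    bounded_mf (fun t => u t + v t).
Proof.
move=> [mu [M uM]] [mv [N vN]]; split; first exact: measurable_funD.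
by exists (M + N) => t; apply: le_trans (ler_normD _ _) _; exact: lerD.
Qed.

Lemma bounded_mfM u v : bounded_mf u -> bounded_mf v ->
    bounded_mf (fun t => u t * v t).
Proof.
move=> [mu [M uM]] [mv [N vN]]; split; first exact: measurable_funM.
by exists (M * N) => t; rewrite normrM; exact: ler_pM.
Qed.

Lemma bounded_mfZ (c : R) v : bounded_mf v -> bounded_mf (fun t => c * v t).
Proof. by move=> bv; apply: bounded_mfM => //; exact: bounded_mf_cst. Qed.

Lemma bounded_mfB u v : bounded_mf u -> bounded_mf v ->
    bounded_mf (fun t => u t - v t).
Proof.
move=> bu bv; apply: bounded_mfD => //.
by under eq_fun do rewrite -mulN1r; exact: bounded_mfZ.
Qed.

Lemma bounded_mf_norm v : bounded_mf v -> bounded_mf (fun t => `|v t|).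
Proof.
move=> [mv [M vM]]; split; first exact: measurableT_comp.
by exists M => t; rewrite normr_id.
Qed.

Lemma bounded_mf_sum (I : finType) (v : I -> T -> R) :
  (forall i, bounded_mf (v i)) -> bounded_mf (fun t => \sum_i v i t).
Proof.
move=> bv; elim: (index_enum I) => [|i s IH].
  by under eq_fun do rewrite big_nil; exact: bounded_mf_cst.
by under eq_fun do rewrite big_cons; exact: bounded_mfD.
Qed.

Lemma bounded_mf_sqr v : bounded_mf v -> bounded_mf (fun t => v t ^+ 2).
Proof. by move=> bv; under eq_fun do rewrite expr2; exact: bounded_mfM. Qed.

Lemma bounded_mf_integrable (P : probability T R) v :
  bounded_mf v -> P.-integrable setT (EFin \o v).
Proof.
move=> [mv [M vM]]; apply: measurable_bounded_integrable => //.
  by apply: le_lt_trans (probability_le1 P measurableT) _; exact: ltry.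
exists M; split; first exact: num_real.
by move=> N /ltW MN t _; exact: le_trans (vM t) MN.
Qed.

Lemma Rintegral_bounded_mf_sum (P : probability T R) (I : finType)
    (v : I -> T -> R) :
  (forall i, bounded_mf (v i)) ->
      \int[P]_t (\sum_i v i t) = \sum_i \int[P]_t v i t.
Proof.
move=> bv; suff [_ ->] : bounded_mf (fun t => \sum_i v i t) /\
  \int[P]_t (\sum_i v i t) = \sum_i \int[P]_t v i t by [].
elim: (index_enum I) => [|i s [bs IH]].
  split; first by under eq_fun do rewrite big_nil; exact: bounded_mf_cst.
  by under eq_Rintegral do rewrite big_nil;
    rewrite big_nil Rintegral_cst ?mul0r.
split; first by under eq_fun do rewrite big_cons; exact: bounded_mfD.
under eq_Rintegral do rewrite big_cons.
by rewrite big_cons RintegralD ?IH//; exact: bounded_mf_integrable.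
Qed.

End bounded_functions.

(** * Means through one channel *)

Section channel.
Context (R : realType) (d : measure_display) (Z : measurableType d).
Context (X : set R) (mX : measurable X) (mu : R -> probability Z R).
Hypothesis mmu : forall v : Z -> R, measurable_fun setT v ->
  (forall t, 0 <= v t) ->
  measurable_fun setT (fun x => \int[mu x]_t (v t)%:E)%E.
Implicit Types (g h : R -> R) (v w : Z -> R).

Local Notation leb := (@lebesgue_measure R).

Definition channel_mean v x := \int[mu x]_t v t.
(** The mean of v(Z) when the input has the possibly signed density g. *)
Definition output_mean g v := \int[leb]_(x in X) (g x * channel_mean v x).

Lemma channel_meanD v w x : bounded_mf v -> bounded_mf w ->
  channel_mean (fun t => v t + w t) x = channel_mean v x + channel_mean w x.
Proof. by move=> bv bw; rewrite /channel_mean RintegralD//;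
  exact: bounded_mf_integrable. Qed.

Lemma channel_meanZ (c : R) v x : bounded_mf v ->
    channel_mean (fun t => c * v t) x = c * channel_mean v x.
Proof. by move=> bv; rewrite /channel_mean RintegralZl//;
  exact: bounded_mf_integrable. Qed.

Lemma channel_meanB v w x : bounded_mf v -> bounded_mf w ->
  channel_mean (fun t => v t - w t) x = channel_mean v x - channel_mean w x.
Proof. by move=> bv bw; rewrite /channel_mean RintegralB//;
  exact: bounded_mf_integrable. Qed.

Lemma channel_mean_cst (c : R) x : channel_mean (fun=> c) x = c.
Proof.
transitivity (c * fine (mu x setT)); first exact: Rintegral_cst.
by rewrite probability_setT mulr1.
Qed.

Lemma channel_mean_le v w x : bounded_mf v -> bounded_mf w ->
    (forall t, v t <= w t) ->
  channel_mean v x <= channel_mean w x.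
Proof.
by move=> bv bw vw; apply: le_Rintegral => //; exact: bounded_mf_integrable.
Qed.

Lemma channel_mean_ge0 v x : (forall t, 0 <= v t) -> 0 <= channel_mean v x.
Proof. by move=> v0; exact: Rintegral_ge0. Qed.

Lemma channel_mean_EFin v x : bounded_mf v ->
    (\int[mu x]_t (v t)%:E = (channel_mean v x)%:E)%E.
Proof.
move=> bv; rewrite /channel_mean /Rintegral fineK//.
by apply: integrable_fin_num => //; exact: bounded_mf_integrable.
Qed.

Lemma bounded_mf_channel_mean v : bounded_mf v -> bounded_mf (channel_mean v).
Proof.
move=> bv; have [mv [M vM]] := bv; split.
  have -> : channel_mean v = fun x => channel_mean (fun t => v t + M) x - M.
    apply/funext => x; rewrite channel_meanD//; last exact: bounded_mf_cst.
    by rewrite channel_mean_cst addrK.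
  apply: measurable_funB => //.
  have bvM : bounded_mf (fun t => v t + M) by apply: bounded_mfD => //;
    exact: bounded_mf_cst.
  apply/measurable_EFinP; rewrite /comp.
  under eq_fun do rewrite -channel_mean_EFin//.
  apply: mmu; first by case: bvM.
  by move=> t; rewrite -lerBlDr sub0r; have := vM t;
    rewrite ler_norml => /andP[].
exists M => x;
  rewrite ler_norml -[X in X <= _](channel_mean_cst _ x)
      -[X in _ && (_ <= X)](channel_mean_cst _ x).
by apply/andP; split; apply: channel_mean_le => //; try exact: bounded_mf_cst;
  move=> t; have := vM t; rewrite ler_norml => /andP[].
Qed.

Lemma integrable_output_mean g v : leb.-integrable X (EFin \o g) ->
    bounded_mf v ->
  leb.-integrable X (EFin \o (fun x => g x * channel_mean v x)).
Proof.
move=> ig bv; have [mc [M cM]] := bounded_mf_channel_mean bv.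
apply: (@le_integrable _ _ _ leb X mX _ (EFin \o (fun x => M * g x))).
- apply/measurable_EFinP; apply: measurable_funM; last exact: measurable_funTS.
  by apply/measurable_EFinP; case/integrableP : ig.
- move=> x Xx /=; rewrite lee_fin !normrM mulrC ler_wpM2r//.
  by apply: le_trans (cM x) _; exact: ler_norm.
- exact: (@integrableZl _ _ _ leb X mX M _ ig).
Qed.

Section output_mean_linear.
Variables (g h : R -> R).
Hypotheses (ig : leb.-integrable X (EFin \o g))
    (ih : leb.-integrable X (EFin \o h)).

Lemma output_meanD v w : bounded_mf v -> bounded_mf w ->
  output_mean g (fun t => v t + w t) = output_mean g v + output_mean g w.
Proof.
move=> bv bw; rewrite /output_mean -RintegralD//;
  try exact: integrable_output_mean.
by apply: eq_Rintegral => x _; rewrite channel_meanD// mulrDr.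
Qed.

Lemma output_meanZ (c : R) v : bounded_mf v ->
    output_mean g (fun t => c * v t) = c * output_mean g v.
Proof.
move=> bv; rewrite /output_mean -RintegralZl//;
  try exact: integrable_output_mean.
by apply: eq_Rintegral => x _; rewrite channel_meanZ// mulrCA.
Qed.

Lemma output_mean_cst (c : R) : output_mean g (fun=> c) =
    c * \int[leb]_(x in X) g x.
Proof.
rewrite -RintegralZl//; apply: eq_Rintegral => x _.
by rewrite channel_mean_cst mulrC.
Qed.

Lemma output_mean_sum (I : finType)
    (v : I -> Z -> R) : (forall i, bounded_mf (v i)) ->
  output_mean g (fun t => \sum_i v i t) = \sum_i output_mean g (v i).
Proof.
move=> bv; elim: (index_enum I) => [|i s IH].
  rewrite big_nil; under [fun t => _]funext do rewrite big_nil.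
  by rewrite output_mean_cst mul0r.
rewrite big_cons; under [fun t => _]funext do rewrite big_cons.
rewrite output_meanD ?IH//; elim: s {IH} => [|k s IH].
  by under eq_fun do rewrite big_nil; exact: bounded_mf_cst.
by under eq_fun do rewrite big_cons; exact: bounded_mfD.
Qed.

Lemma output_mean_ge0 v : (forall x, X x -> 0 <= g x) -> (forall t, 0 <= v t) ->
  0 <= output_mean g v.
Proof.
by move=> g0 v0; apply: Rintegral_ge0 => x Xx;
  rewrite mulr_ge0 ?g0 ?channel_mean_ge0.
Qed.

Lemma output_meanDl v : bounded_mf v ->
    output_mean (fun x => g x + h x) v = output_mean g v + output_mean h v.
Proof.
move=> bv; rewrite /output_mean -RintegralD//;
  try exact: integrable_output_mean.
by apply: eq_Rintegral => x _; rewrite mulrDl.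
Qed.

Lemma output_meanZl (c : R) v : bounded_mf v ->
    output_mean (fun x => c * g x) v = c * output_mean g v.
Proof.
move=> bv; rewrite /output_mean -RintegralZl//;
  try exact: integrable_output_mean.
by apply: eq_Rintegral => x _; rewrite mulrA.
Qed.

End output_mean_linear.

Lemma output_mean_le g v w : leb.-integrable X (EFin \o g) ->
  (forall x, X x -> 0 <= g x) -> bounded_mf v -> bounded_mf w ->
  (forall t, v t <= w t) -> output_mean g v <= output_mean g w.
Proof.
move=> ig g0 bv bw vw; apply: le_Rintegral => //;
  try exact: integrable_output_mean.
by move=> x Xx; rewrite ler_wpM2l ?g0// channel_mean_le.
Qed.

End channel.

(** * The effect of privacy *)

Lemma prob_density_integrable (R : realType) (X : set R) f :
  prob_density X f -> (@lebesgue_measure R).-integrable X (EFin \o f).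
Proof.
case=> mf f0 f1; apply/integrableP; split; first exact/measurable_EFinP.
suff -> : (\int[lebesgue_measure]_(x in X) `|(EFin \o f) x| = 1)%E
    by rewrite ltry.
by rewrite -f1; apply: eq_integral => x /[!inE] Xx /=; rewrite ger0_norm// f0.
Qed.

Lemma prob_density_Rintegral (R : realType) (X : set R) f :
  prob_density X f -> \int[@lebesgue_measure R]_(x in X) f x = 1.
Proof. by case=> _ _ f1; rewrite /Rintegral f1. Qed.

Section private_channel.
Context (R : realType) (d : measure_display) (Z : measurableType d).
Context (X : set R) (mX : measurable X) (mu : R -> probability Z R).
Hypothesis mmu : forall v : Z -> R, measurable_fun setT v ->
  (forall t, 0 <= v t) ->
  measurable_fun setT (fun x => \int[mu x]_t (v t)%:E)%E.
Variables (alpha : R) (alpha_ge0 : 0 <= alpha).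
Hypothesis mu_ldp : forall A x y, measurable A -> X x -> X y ->
  (mu x A <= (expR alpha)%:E * mu y A)%E.
Local Notation leb := (@lebesgue_measure R).
Implicit Types v w : Z -> R.

Lemma channel_mean_ldp v x y : bounded_mf v -> (forall t, 0 <= v t) -> X x ->
    X y ->
  channel_mean mu v x <= expR alpha * channel_mean mu v y.
Proof.
move=> bv v0 Xx Xy; rewrite -lee_fin EFinM -!channel_mean_EFin//.
have mv : measurable_fun setT (EFin \o v) by apply/measurable_EFinP; case: bv.
have e0 : 0 <= expR alpha by exact: expR_ge0.
rewrite -[leRHS](ge0_integral_mscale (mu y) measurableT (NngNum e0) mv).
  apply: ge0_le_measure_integral => //.
  by move=> A mA; exact: mu_ldp.
by move=> t _; rewrite lee_fin.
Qed.

Let channel_mean_contrast_ge0 v x y : bounded_mf v -> (forall t, 0 <= v t) ->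
    X x -> X y ->
  `|channel_mean mu v x - channel_mean mu v y| <=
      (expR alpha - 1) * channel_mean mu v y.
Proof.
move=> bv v0 Xx Xy.
have E1 : 1 <= expR alpha by rewrite -expR0 ler_expR.
have xy := channel_mean_ldp bv v0 Xx Xy;
  have yx := channel_mean_ldp bv v0 Xy Xx.
have x0 := channel_mean_ge0 mu x v0; have y0 := channel_mean_ge0 mu y v0.
by rewrite ler_norml; apply/andP; split; nra.
Qed.

(** The privacy inequality compares nonnegative functions.  It is applied to
    |v| + v and |v| - v, whose half-difference is v and whose half-sum is
    |v|. *)
Lemma channel_mean_contrast v x y : bounded_mf v -> X x -> X y ->
  `|channel_mean mu v x - channel_mean mu v y| <=
  (expR alpha - 1) * channel_mean mu (fun t => `|v t|) y.
Proof.
move=> bv Xx Xy; have bn := bounded_mf_norm bv.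
pose p t := `|v t| + v t; pose q t := `|v t| - v t.
have bp : bounded_mf p by exact: bounded_mfD.
have bq : bounded_mf q by exact: bounded_mfB.
have p0 t : 0 <= p t by rewrite /p -lerBlDr sub0r -normrN ler_norm.
have q0 t : 0 <= q t by rewrite /q subr_ge0 ler_norm.
have vE z : channel_mean mu v z =
    2^-1 * (channel_mean mu p z - channel_mean mu q z).
  have -> : p = fun t => q t + 2 * v t by apply/funext => t; rewrite /p /q;
    ring.
  by rewrite channel_meanD ?channel_meanZ//; [field|exact: bounded_mfZ].
have nE z : channel_mean mu (fun t => `|v t|) z =
    2^-1 * (channel_mean mu p z + channel_mean mu q z).
  rewrite -channel_meanD// -channel_meanZ; last exact: bounded_mfD.
  by congr (channel_mean mu _ z); apply/funext => t; rewrite /p /q; field.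
have := channel_mean_contrast_ge0 bp p0 Xx Xy;
  have := channel_mean_contrast_ge0 bq q0 Xx Xy.
rewrite !vE nE !ler_norml => /andP[a b] /andP[c e].
by apply/andP; split; lra.
Qed.

Variables (f : R -> R) (df : prob_density X f).
Let f0 x : X x -> 0 <= f x. Proof. by case: df => _ + _; exact. Qed.
Let If := prob_density_integrable df.

(** As psi integrates to zero, the mean of v(Z) given x may be centred at its
    mean under f, and privacy bounds what is left by (e^alpha - 1) times the
    mean of |v(Z)| under f. *)
Lemma output_mean_contrast (psi : R -> R) (a : R) v :
  leb.-integrable X (EFin \o psi) -> \int[leb]_(x in X) psi x = 0 ->
  \int[leb]_(x in X) `|psi x| <= a -> bounded_mf v ->
  `|output_mean X mu psi v| <=
    (expR alpha - 1) * a * output_mean X mu f (fun t => `|v t|).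
Proof.
move=> ip p0 pa bv; have bn := bounded_mf_norm bv.
set S := output_mean X mu f _; pose m := output_mean X mu f v.
have E0 : 0 <= expR alpha - 1 by rewrite subr_ge0 -expR0 ler_expR.
have S0 : 0 <= S by apply: output_mean_ge0.
have dev x : X x -> `|channel_mean mu v x - m| <= (expR alpha - 1) * S.
  move=> Xx; have -> : channel_mean mu v x - m =
      \int[leb]_(y in X) (f y * (channel_mean mu v x - channel_mean mu v y)).
    under eq_Rintegral do rewrite mulrBr.
    rewrite RintegralB//; last 2 first.
      - have := @integrableZr _ _ _ leb X mX (channel_mean mu v x) _ If.
        by apply: eq_integrable.
      - exact: integrable_output_mean.
    by rewrite RintegralZr// (prob_density_Rintegral df) mul1r.
  have ii : leb.-integrable X
      (EFin \o (fun y => f y * (channel_mean mu v x - channel_mean mu v y))).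
    have bx : bounded_mf (fun t => channel_mean mu v x - v t).
      by apply: bounded_mfB => //; exact: bounded_mf_cst.
    have := integrable_output_mean mX mmu If bx;
      apply: eq_integrable => // y _ /=.
    by rewrite channel_meanB ?channel_mean_cst//; exact: bounded_mf_cst.
  apply: le_trans (le_normr_Rintegral _ _) _ => //.
  rewrite /S /output_mean -RintegralZl//; last exact: integrable_output_mean.
  apply: le_Rintegral => //.
  - have := integrable_norm ii. by apply: eq_integrable.
  - have := @integrableZl _ _ _ leb X mX (expR alpha - 1)
      _ (integrable_output_mean mX mmu If bn).
    by apply: eq_integrable.
  - move=> y Xy; rewrite normrM ger0_norm ?f0// mulrCA ler_wpM2l ?f0//.
    exact: channel_mean_contrast.
have -> : output_mean X mu psi v =
    \int[leb]_(x in X) (psi x * (channel_mean mu v x - m)).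
  under [RHS]eq_Rintegral do rewrite mulrBr.
  rewrite RintegralB//; [|exact: integrable_output_mean|].
    by rewrite RintegralZr// p0 mul0r subr0.
  have := @integrableZr _ _ _ leb X mX m _ ip.
  by apply: eq_integrable.
have ii : leb.-integrable X (EFin \o (fun x =>
    psi x * (channel_mean mu v x - m))).
  have bm : bounded_mf (fun t => v t - m) by apply: bounded_mfB => //;
    exact: bounded_mf_cst.
  have := integrable_output_mean mX mmu ip bm;
    apply: eq_integrable => // y _ /=.
  by rewrite channel_meanB ?channel_mean_cst//; exact: bounded_mf_cst.
apply: le_trans (le_normr_Rintegral _ _) _ => //.
have in_ : leb.-integrable X (EFin \o (fun x => `|psi x|)).
  by have := integrable_norm ip; apply: eq_integrable.
apply: (@le_trans _ _ (\int[leb]_(x in X) (`|psi x| * ((expR alpha - 1) * S)))).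
  apply: le_Rintegral => //.
  - by have := integrable_norm ii; apply: eq_integrable.
  - have := @integrableZr _ _ _ leb X mX ((expR alpha - 1) * S) _ in_.
    by apply: eq_integrable.
  - by move=> x Xx; rewrite normrM ler_wpM2l// dev.
rewrite RintegralZr// (_ : _ * a * S = a * ((expR alpha - 1) * S));
  last by ring.
by rewrite ler_wpM2r// mulr_ge0.
Qed.

End private_channel.

(** * One step of interaction *)

Section one_step.
Context (R : realType) (d : measure_display) (Z : measurableType d).
Context (X : set R) (mX : measurable X) (mu : R -> probability Z R).
Hypothesis mmu : forall v : Z -> R, measurable_fun setT v ->
  (forall t, 0 <= v t) ->
  measurable_fun setT (fun x => \int[mu x]_t (v t)%:E)%E.
Variables (alpha : R) (alpha_ge0 : 0 <= alpha).
Hypothesis mu_ldp : forall A x y, measurable A -> X x -> X y ->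
  (mu x A <= (expR alpha)%:E * mu y A)%E.
Local Notation leb := (@lebesgue_measure R).
Variables (f : R -> R) (df : prob_density X f).
Variables (Om J : finType) (e : J -> Om -> R).
Hypothesis orth :
  forall j k, \sum_w e j w * e k w = (j == k)%:R * #|Om|%:R.
Variables (psi : J -> R -> R) (a : J -> R).
Hypothesis ipsi : forall j, leb.-integrable X (EFin \o psi j).
Hypothesis psi0 : forall j, \int[leb]_(x in X) psi j x = 0.
Hypothesis psia : forall j, \int[leb]_(x in X) `|psi j x| <= a j.
Variables (g : Om -> R -> R).
Hypothesis gE :
  forall w x, X x -> g w x = f x + \sum_j e j w * psi j x.

Let If := prob_density_integrable df.
Let f_ge0 x : X x -> 0 <= f x. Proof. by case: df => _ + _; exact. Qed.

Let output_mean_family w v : bounded_mf v ->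
  output_mean X mu (g w) v = output_mean X mu f v + \sum_j e j w * output_mean X mu (psi j) v.
Proof.
move=> bv.
suff [ih <-] : leb.-integrable X (EFin \o (fun x => \sum_j e j w * psi j x)) /\
    output_mean X mu (fun x => \sum_j e j w * psi j x) v =
    \sum_j e j w * output_mean X mu (psi j) v.
  rewrite -output_meanDl//; apply: eq_Rintegral => x /[!inE] Xx.
  by rewrite gE.
elim: (index_enum J) => [|j s [ih IH]].
  rewrite big_nil; split.
    have := @integrableZl _ _ _ leb X mX 0 _ If;
      apply: eq_integrable => //= x _.
    by rewrite big_nil mul0e.
  rewrite /output_mean; under eq_Rintegral do rewrite big_nil mul0r.
  by rewrite Rintegral_cst// mul0r.
have ij : leb.-integrable X (EFin \o (fun x => e j w * psi j x)).
  by have := @integrableZl _ _ _ leb X mX (e j w) _ (ipsi j);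
    apply: eq_integrable.
split.
  have := @integrableD _ _ _ leb X mX _ _ ij ih;
    apply: eq_integrable => //= x _.
  by rewrite big_cons.
rewrite big_cons -IH -output_meanZl// -output_meanDl//.
by apply: eq_Rintegral => x _; rewrite big_cons.
Qed.

(** With b_w the mean of v_w under g_w and u_w = v_w - b_w, expanding the
    quadratic around b_w shows that the two potentials differ by
      (1 - 2 lam b_w) E u_w - lam E u_w^2,
    where E is the mean under f and E u_w = - sum_j e_j(w) R_j(u_w).  Summing
    over w, the linear part is - sum_j R_j(W_j), W_j being (up to
    normalisation) the j-th coefficient of w |-> (1 - 2 lam b_w) u_w.  Bessel's
    inequality makes sum_j W_j^2 at most |Om| sum_w u_w^2, so the quadratic part
    absorbs the linear one up to the square completion constant. *)
Lemma one_step_bound (lam : R) (v : Om -> Z -> R) : (0 < #|Om|)%N ->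
    0 < lam <= 1 ->
  (forall w, prob_density X (g w)) ->
  (forall w, measurable_fun setT (v w)) -> (forall w t, 0 <= v w t <= 1) ->
  \sum_w output_mean X mu f (fun t => v w t - lam * v w t ^+ 2) <=
  \sum_w (output_mean X mu (g w) (v w) - lam * output_mean X mu (g w)
      (v w) ^+ 2) +
  #|Om|%:R * \sum_j ((expR alpha - 1) * a j) ^+ 2 / (4 * lam).
Proof.
move=> Om0 /andP[lam0 lam1] dg mv v01.
have bv w : bounded_mf (v w).
  by split => //; exists 1 => t; have /andP[? ?] := v01 w t; rewrite ger0_norm.
pose b w := output_mean X mu (g w) (v w).
have b01 w : 0 <= b w <= 1.
  have [mg g0 g1] := dg w; apply/andP; split.
    by apply: output_mean_ge0 => // t; case/andP: (v01 w t).
  rewrite -[leRHS](prob_density_Rintegral (dg w)) -[leRHS]mul1r.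
  rewrite -(output_mean_cst mX mu (prob_density_integrable (dg w)) 1).
  apply: output_mean_le => //; first exact: prob_density_integrable.
    exact: bounded_mf_cst.
  by move=> t; case/andP: (v01 w t).
(* The derivative of b - lam b^2, the weight of the linear term below. *)
pose c w := 1 - 2 * lam * b w.
have c1 w : c w ^+ 2 <= 1.
  have /andP[b0 b1] := b01 w.
  have [lb0 lb1] : 0 <= lam * b w /\ lam * b w <= 1.
    by split; [apply: mulr_ge0 => //; exact: ltW|rewrite mulr_ile1// ltW].
  by rewrite /c; nra.
pose u w t := v w t - b w.
have bu w : bounded_mf (u w) by apply: bounded_mfB => //; exact: bounded_mf_cst.
pose P := output_mean X mu f; pose r j := output_mean X mu (psi j).
have Pu w : P (u w) = - \sum_j e j w * r j (u w).
  apply/eqP; rewrite -addr_eq0 -output_mean_family//.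
  rewrite /u output_meanD//; last by exact: bounded_mf_cst.
    by rewrite output_mean_cst ?(prob_density_Rintegral (dg w)) ?mulr1 ?subrr//;
      exact: prob_density_integrable.
  exact: prob_density_integrable.
have step w : P (fun t => v w t - lam * v w t ^+ 2) =
    b w - lam * b w ^+ 2 - \sum_j r j (fun t => e j w * c w * u w t) -
    lam * P (fun t => u w t ^+ 2).
  have -> : (fun t => v w t - lam * v w t ^+ 2) =
      (fun t => (b w - lam * b w ^+ 2) + (c w * u w t + (- lam) * u w t ^+ 2)).
    by apply/funext => t; rewrite /u /c; ring.
  have bu2 := bounded_mf_sqr (bu w).
  rewrite /P output_meanD//;
    [|exact: bounded_mf_cst|by apply: bounded_mfD; exact: bounded_mfZ].
  rewrite output_mean_cst// (prob_density_Rintegral df) mulr1.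
  rewrite output_meanD//; [|exact: bounded_mfZ|exact: bounded_mfZ].
  have -> : \sum_j r j (fun t => e j w * c w * u w t) = - (c w * P (u w)).
    rewrite Pu mulrN opprK mulr_sumr; apply: eq_bigr => j _.
    by rewrite [LHS]output_meanZ// -/(r j (u w)); ring.
  have -> : output_mean X mu f (fun t => c w * u w t) =
      c w * P (u w) by exact: output_meanZ.
  rewrite [X in _ + (_ + X)]output_meanZ// -/(P _); ring.
pose W j t := \sum_w e j w * c w * u w t.
have bW j : bounded_mf (W j) by apply: bounded_mf_sum => w; exact: bounded_mfZ.
have rW : \sum_w \sum_j r j (fun t => e j w * c w * u w t) = \sum_j r j (W j).
  rewrite exchange_big; apply: eq_bigr => j _ /=.
  by rewrite -output_mean_sum// => w; exact: bounded_mfZ.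
rewrite (eq_bigr _ (fun w _ => step w)) !sumrB rW -!addrA lerD2l.
pose N : R := #|Om|%:R.
pose kap j := (expR alpha - 1) * a j.
have contrast j : - r j (W j) <= kap j * P (fun t => `|W j t|).
  apply: le_trans (ler_norm _) _; rewrite normrN.
  by apply: (output_mean_contrast mX mmu alpha_ge0 mu_ldp).
have N0 : 0 < N by rewrite ltr0n.
(* Young's inequality, tuned so that the squares sum to what Bessel allows. *)
have young j t : kap j * `|W j t| <=
    lam / N * W j t ^+ 2 + N * (kap j ^+ 2 / (4 * lam)).
  have -> : W j t ^+ 2 = `|W j t| ^+ 2 by rewrite real_normK// num_real.
  set x := `|_|; rewrite -subr_ge0.
  have -> : lam / N * x ^+ 2 + N * (kap j ^+ 2 / (4 * lam)) - kap j * x =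
      lam / N * (x - N * kap j / (2 * lam)) ^+ 2.
    by field; rewrite !gt_eqF.
  by rewrite mulr_ge0 ?sqr_ge0// divr_ge0 ?ltW.
have bW2 j := bounded_mf_sqr (bW j); have bWn j := bounded_mf_norm (bW j).
have bu2 w := bounded_mf_sqr (bu w).
have rbound j : - r j (W j) <=
    lam / N * P (fun t => W j t ^+ 2) + N * (kap j ^+ 2 / (4 * lam)).
  apply: le_trans (contrast j) _.
  rewrite /P -output_meanZ//.
  apply: (@le_trans _ _ (output_mean X mu f
      (fun t => lam / N * W j t ^+ 2 + N * (kap j ^+ 2 / (4 * lam))))).
    apply: output_mean_le => //; first exact: bounded_mfZ.
    by apply: bounded_mfD; [exact: bounded_mfZ|exact: bounded_mf_cst].
  rewrite output_meanD//; [|exact: bounded_mfZ|exact: bounded_mf_cst].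
  by rewrite output_meanZ// output_mean_cst// (prob_density_Rintegral df) mulr1.
(* Bessel's inequality at each output t, averaged under f. *)
have energy : \sum_j P (fun t => W j t ^+ 2) <=
    N * \sum_w P (fun t => u w t ^+ 2).
  rewrite -!output_mean_sum// -output_meanZ//; last exact: bounded_mf_sum.
  apply: output_mean_le => //;
    [exact: bounded_mf_sum|by apply: bounded_mfZ; exact: bounded_mf_sum|].
  move=> t; have := bessel (fun w => c w * u w t) orth.
  rewrite (eq_bigr (fun j => W j t ^+ 2)); last first.
    by move=> j _; rewrite /W; congr (_ ^+ 2); apply: eq_bigr => w _;
      rewrite mulrA.
  move=> /le_trans; apply; apply: (ler_wpM2l (ltW N0)); apply: ler_sum => w _.
  by rewrite exprMn ler_piMl ?sqr_ge0.
have : \sum_j - r j (W j) <= \sum_j (lam / N * P (fun t => W j t ^+ 2) +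
    N * (kap j ^+ 2 / (4 * lam))) by apply: ler_sum => j _.
rewrite sumrN big_split/= -!mulr_sumr -/N.
have : lam / N * \sum_j P (fun t => W j t ^+ 2) <=
    lam * \sum_w P (fun t => u w t ^+ 2).
  rewrite mulrAC ler_pdivrMr// -mulrA; apply: (ler_wpM2l (ltW lam0)).
  by rewrite [leRHS]mulrC.
rewrite /P; lra.
Qed.
End one_step.

(** * The quadratic potential along the interaction *)

Section channel_at.
Context (R : realType) (d : measure_display) (Z : measurableType d).
Context (X : set R) (mX : measurable X) (Q : mechanism R Z) (i : nat).
Variable z : i.-tuple Z.

Definition channel_at (x : R) : set Z -> \bar R := Q i (x, z).

HB.instance Definition _ x := Measure.on (channel_at x).

HB.instance Definition _ x :=
  Measure_isProbability.Build _ _ R (channel_at x) (prob_kernel (x, z)).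

Lemma measurable_channel_at (v : Z -> R) : measurable_fun setT v ->
  (forall t, 0 <= v t) ->
  measurable_fun setT (fun x => \int[channel_at x]_t (v t)%:E)%E.
Proof.
move=> mv v0; apply: measurable_fun_integral_kernel => //.
- move=> A mA; have mp : measurable_fun [set: R] (fun x => (x, z)).
    by apply/measurable_fun_pairP; split;
      [exact: measurable_id|exact: measurable_cst].
  exact: (measurableT_comp (measurable_kernel (Q i) A mA) mp).
- exact/measurable_EFinP.
Qed.

End channel_at.

Section law_step.
Context (R : realType) (d : measure_display) (Z : measurableType d).
Context (X : set R) (mX : measurable X) (Q : mechanism R Z) (f : R -> R).
Context (df : prob_density X f) (i : nat) (v : i.+1.-tuple Z -> R).
Hypotheses (mv : measurable_fun setT v) (v01 : forall t, 0 <= v t <= 1).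

(** The conditional expectation of v given the first i outputs. *)
Definition cond_mean (z : i.-tuple Z) : R :=
  output_mean X (channel_at Q z) f (fun z' => v [tuple of rcons z z']).

Lemma measurable_rcons_section (z : i.-tuple Z) :
  measurable_fun setT (fun z' => v [tuple of rcons z z']).
Proof.
apply: measurableT_comp => //.
exact: measurableT_comp (@measurable_rcons _ Z i) (pair1_measurable z).
Qed.

Lemma bounded_mf01 d' (T : measurableType d') (u : T -> R) :
  measurable_fun setT u -> (forall t, 0 <= u t <= 1) -> bounded_mf u.
Proof.
move=> mu u01; split => //; exists 1 => t.
by have /andP[? ?] := u01 t; rewrite ger0_norm.
Qed.

Let bv (z : i.-tuple Z) : bounded_mf (fun z' => v [tuple of rcons z z']).
Proof. by apply: bounded_mf01 => //; exact: measurable_rcons_section. Qed.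

Lemma cond_mean01 z : 0 <= cond_mean z <= 1.
Proof.
have If := prob_density_integrable df; have [mf f0 f1] := df.
apply/andP; split.
  by apply: output_mean_ge0 => // t; case/andP: (v01 [tuple of rcons z t]).
rewrite -[leRHS](prob_density_Rintegral df) -[leRHS]mul1r.
rewrite -(output_mean_cst mX (channel_at Q z) If 1).
apply: output_mean_le => //; first exact: measurable_channel_at.
  exact: bounded_mf_cst.
by move=> t; case/andP: (v01 [tuple of rcons z t]).
Qed.

Let cond_meanE z : ((cond_mean z)%:E =
  \int[lebesgue_measure]_(x in X) ((f x)%:E *
    \int[Q i (x, z)]_z' (v [tuple of rcons z z'])%:E))%E.
Proof.
have If := prob_density_integrable df.
rewrite /cond_mean /output_mean /Rintegral fineK; last first.
  apply: integrable_fin_num => //.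
  by apply: integrable_output_mean => //; exact: measurable_channel_at.
by apply: eq_integral => x _; rewrite EFinM -channel_mean_EFin.
Qed.

Lemma measurable_cond_mean : measurable_fun setT cond_mean.
Proof.
apply/measurable_EFinP; rewrite /comp (funext cond_meanE).
by apply: measurable_private_step => // t; case/andP: (v01 t).
Qed.

Lemma Rintegral_private_law (P : probability (i.-tuple Z) R)
    (P' : probability (i.+1.-tuple Z) R) :
  (P : set _ -> \bar R) = private_law X Q f (n := i) ->
  (P' : set _ -> \bar R) = private_law X Q f (n := i.+1) ->
  \int[P']_t v t = \int[P]_z cond_mean z.
Proof.
move=> eP eP'; rewrite /Rintegral; congr fine.
rewrite (integral_private_law mX df eP eP')//; last by move=> t;
  case/andP: (v01 t).
by apply: eq_integral => z _; rewrite -cond_meanE.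
Qed.

End law_step.

Section interaction.
Context (R : realType) (d : measure_display) (Z : measurableType d).
Context (X : set R) (mX : measurable X) (Q : mechanism R Z) (n : nat).
Variables (alpha : R) (alpha_ge0 : 0 <= alpha).
Hypothesis Q_ldp : ldp X n alpha Q.
Local Notation leb := (@lebesgue_measure R).
Variables (f : R -> R) (df : prob_density X f).
Variables (Om J : finType) (e : J -> Om -> R).
Hypothesis Om0 : (0 < #|Om|)%N.
Hypothesis orth :
  forall j k, \sum_w e j w * e k w = (j == k)%:R * #|Om|%:R.
Variables (psi : J -> R -> R) (a : J -> R).
Hypothesis ipsi : forall j, leb.-integrable X (EFin \o psi j).
Hypothesis psi0 : forall j, \int[leb]_(x in X) psi j x = 0.
Hypothesis psia : forall j, \int[leb]_(x in X) `|psi j x| <= a j.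
Variables (g : Om -> R -> R) (dg : forall w, prob_density X (g w)).
Hypothesis gE :
  forall w x, X x -> g w x = f x + \sum_j e j w * psi j x.
Variables (lam : R) (lam01 : 0 < lam <= 1).

Let cost := \sum_j ((expR alpha - 1) * a j) ^+ 2 / (4 * lam).

(** Peel off the last output.  The functions v_w are replaced by their
    conditional means under g_w, so that the means under the laws Pg w are
    unchanged, and [one_step_bound] at each past z bounds what the potential
    under P gains. *)
Lemma quadratic_potential i (P : probability (i.-tuple Z) R)
    (Pg : Om -> probability (i.-tuple Z) R) (v : Om -> i.-tuple Z -> R) :
  (i <= n)%N ->
  (P : set _ -> \bar R) = private_law X Q f (n := i) ->
  (forall w, (Pg w : set _ -> \bar R) = private_law X Q (g w) (n := i)) ->
  (forall w, measurable_fun setT (v w)) -> (forall w t, 0 <= v w t <= 1) ->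
  \sum_w \int[P]_t (v w t - lam * v w t ^+ 2) <=
  \sum_w ((\int[Pg w]_t v w t) - lam * (\int[Pg w]_t v w t) ^+ 2) +
  i%:R * (#|Om|%:R * cost).
Proof.
have /andP[lam0 lam1] := lam01.
elim: i P Pg v => [|i IH] P Pg v ltin eP ePg mv v01.
  rewrite mul0r addr0; apply: ler_sum => w _.
  have dir (h : R -> R) (P0 : probability (0.-tuple Z) R)
      (u : 0.-tuple Z -> R) :
      (P0 : set _ -> \bar R) = private_law X Q h (n := 0) ->
      measurable_fun setT u -> \int[P0]_t u t = u [tuple].
    move=> eP0 mu; rewrite /Rintegral.
    rewrite (eq_measure_integral (dirac [tuple])); last first.
      by move=> A _ _; transitivity ((P0 : set _ -> \bar R) A) => //;
        rewrite eP0.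
    rewrite integral_dirac ?diracT ?mul1e//.
    exact/measurable_EFinP.
  have mvw := mv w.
  rewrite (dir f P)//; last first.
    by apply: measurable_funB => //; apply: measurable_funM => //;
      exact: measurable_funX.
  by rewrite (dir (g w)).
have [PA ePA] := private_law_probability mX Q df i.
have [PG ePG] := choice (fun w => private_law_probability mX Q (dg w) i).
have vq01 w t : 0 <= v w t - lam * v w t ^+ 2 <= 1.
  have /andP[v0 v1] := v01 w t; have : lam * v w t <= 1.
    by rewrite mulr_ile1// ltW.
  have : 0 <= lam * v w t by rewrite mulr_ge0// ltW.
  by move=> ? ?; apply/andP; split; nra.
have mvq w : measurable_fun setT (fun t => v w t - lam * v w t ^+ 2).
  by apply: measurable_funB => //; apply: measurable_funM => //;
    exact: measurable_funX.
pose V w := cond_mean X Q (g w) (v w).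
have V01 w z : 0 <= V w z <= 1 by exact: cond_mean01.
have mV w : measurable_fun setT (V w) by exact: measurable_cond_mean.
have := IH PA PG V (ltnW ltin) ePA ePG mV V01.
under [X in _ <= X + _ -> _]eq_bigr do
  rewrite -(Rintegral_private_law mX (dg _) (mv _) (v01 _) (ePG _) (ePg _)).
rewrite -natr1 mulrDl mul1r addrA => IH'.
apply: le_trans (lerD IH' (lexx _)).
under eq_bigr do rewrite (Rintegral_private_law mX df (mvq _) (vq01 _) ePA eP).
have bvq w : bounded_mf (cond_mean X Q f (fun t => v w t - lam * v w t ^+ 2)).
  by apply: bounded_mf01 => [|z];
    [exact: measurable_cond_mean|exact: cond_mean01].
have bV w : bounded_mf (fun z => V w z - lam * V w z ^+ 2).
  have bVw : bounded_mf (V w) by exact: bounded_mf01.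
  by apply: bounded_mfB => //; apply: bounded_mfZ; exact: bounded_mf_sqr.
rewrite -!Rintegral_bounded_mf_sum//.
have -> : #|Om|%:R * cost = \int[PA]_z (#|Om|%:R * cost).
  transitivity (#|Om|%:R * cost * fine (PA setT)).
    by rewrite probability_setT mulr1.
  exact/esym/Rintegral_cst.
rewrite -RintegralD//; last 2 first.
- by apply: bounded_mf_integrable; exact: bounded_mf_sum.
- by apply: bounded_mf_integrable; exact: bounded_mf_cst.
apply: le_Rintegral => //.
- by apply: bounded_mf_integrable; exact: bounded_mf_sum.
- apply: bounded_mf_integrable; apply: bounded_mfD; last exact: bounded_mf_cst.
  exact: bounded_mf_sum.
move=> z _;
  apply: (one_step_bound mX _ alpha_ge0 _ df orth ipsi psi0 psia gE) => //.
- exact: measurable_channel_at.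
- by move=> A x y mA Xx Xy; exact: Q_ldp.
- by move=> w; exact: measurable_rcons_section.
Qed.
End interaction.

(** * The risk of an indistinguishable family *)

Section testing.
Context (R : realType) (d : measure_display) (Z : measurableType d).
Context (X : set R) (mX : measurable X) (n : nat).
Variables (beta L alpha gamma rho : R).
Hypotheses (alpha_ge0 : 0 <= alpha) (gamma_lt1 : gamma < 1)
    (gamma_gt0 : 0 < gamma).
Local Notation leb := (@lebesgue_measure R).
Variables (f : R -> R) (df : prob_density X f).
Variables (Om J : finType) (e : J -> Om -> R).
Hypothesis Om0 : (0 < #|Om|)%N.
Hypothesis orth :
  forall j k, \sum_w e j w * e k w = (j == k)%:R * #|Om|%:R.
Variables (psi : J -> R -> R) (a : J -> R).
Hypothesis ipsi : forall j, leb.-integrable X (EFin \o psi j).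
Hypothesis psi0 : forall j, \int[leb]_(x in X) psi j x = 0.
Hypothesis psia : forall j, \int[leb]_(x in X) `|psi j x| <= a j.
Variable g : Om -> R -> R.
Hypothesis ag : forall w, alternatives X beta L f rho (g w).
Hypothesis gE :
  forall w x, X x -> g w x = f x + \sum_j e j w * psi j x.
Hypothesis info :
  n%:R * \sum_j ((expR alpha - 1) * a j) ^+ 2 <= (1 - gamma) ^+ 2 / 4.

(** The potential is applied to the indicator of acceptance, with
    lam = (1 - gamma) / 4.  On average over w the sum of the two errors is at
    least 1 - lam - (1 - gamma) / 4 = (1 + gamma) / 2, hence it is for some
    w. *)
Lemma private_test_error (Q : mechanism R Z)
    (phi : {mfun n.-tuple Z >-> bool}) :
  ldp X n alpha Q -> exists w,
  (((1 + gamma) / 2)%:E <= private_law X Q f (phi @^-1` [set true]) +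
     private_law X Q (g w) (phi @^-1` [set false]))%E.
Proof.
move=> Q_ldp; have dg w : prob_density X (g w) by case: (ag w).
have [P eP] := private_law_probability mX Q df n.
have [PG ePG] := choice (fun w => private_law_probability mX Q (dg w) n).
have mphi b : measurable (phi @^-1` [set b]) by exact: measurable_funPTI.
pose v (t : n.-tuple Z) : R := \1_(phi @^-1` [set false]) t.
have v01 t : 0 <= v t <= 1 by rewrite /v indicE; case: (_ \in _);
  rewrite /= ?lexx ?ler01.
have vv t : v t ^+ 2 = v t.
  by rewrite /v indicE; case: (_ \in _); rewrite /= ?expr1n ?expr0n.
have mv : measurable_fun setT v by exact: measurable_indic.
have Ev (P0 : probability (n.-tuple Z) R) :
    \int[P0]_t v t = fine (P0 (phi @^-1` [set false])).
  by rewrite /Rintegral integral_indic// setIT.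
(* A quarter of the slack 1 - gamma goes to lam, another to the cost. *)
pose lam := (1 - gamma) / 4.
have [g0 g1] := (gamma_gt0, gamma_lt1).
have lam01 : 0 < lam <= 1 by rewrite /lam; apply/andP; split; lra.
have := quadratic_potential mX alpha_ge0 Q_ldp df Om0 orth ipsi psi0 psia dg gE
  lam01 (leqnn n) eP ePG (fun=> mv) (fun=> v01).
have Pphi : fine (P (phi @^-1` [set true])) =
    1 - fine (P (phi @^-1` [set false])).
  have -> : phi @^-1` [set true] = ~` (phi @^-1` [set false]).
    by apply/seteqP; split => t /=; case: (phi t).
  rewrite probability_setC// fineB//; exact: fin_num_measure.
have finP (P0 : probability (n.-tuple Z) R) b :
    (P0 (phi @^-1` [set b]) = (fine (P0 (phi @^-1` [set b])))%:E)%E.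
  by rewrite fineK// fin_num_measure.
set p := fine (P (phi @^-1` [set false])) in Pphi *.
pose q w := fine (PG w (phi @^-1` [set false])).
set S := \sum_(j : J) _.
have -> : \sum_(w : Om) \int[P]_t (v t - lam * v t ^+ 2) =
    \sum_(w : Om) ((1 - lam) * p).
  apply: eq_bigr => w _; rewrite -[p]Ev -RintegralZl//; last first.
    by apply: bounded_mf_integrable; exact: bounded_mf01.
  by apply: eq_Rintegral => t _; rewrite vv; ring.
(* The total cost of the n steps, by the bound on the information. *)
have cost_le : n%:R * S <= (1 - gamma) / 4.
  rewrite /S -mulr_suml mulrA ler_pdivrMr; last by case/andP: lam01 => ? _;
    rewrite pmulr_rgt0.
  apply: le_trans info _; rewrite /lam; lra.
move=> pot; apply: contrapT => /forallNP none.
have lt w : q w < (1 + gamma) / 2 - (1 - p).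
  rewrite ltrBrDl -lte_fin ltNge; apply/negP => le_; apply: (none w).
  rewrite -eP -ePG.
  have -> : (P : set _ -> \bar R) (phi @^-1` [set true]) = (1 - p)%:E.
    by rewrite -Pphi -finP.
  have -> : (PG w : set _ -> \bar R) (phi @^-1` [set false]) = (q w)%:E.
    by rewrite -finP.
  by rewrite -EFinD.
have p01 : 0 <= p <= 1.
  rewrite fine_ge0//= -lee_fin -finP; exact: probability_le1.
have : \sum_w (\int[PG w]_t v t - lam * (\int[PG w]_t v t) ^+ 2) <
    \sum_(w : Om) ((1 + gamma) / 2 - (1 - p)).
  apply: ltr_sum => [|w _].
    have /card_gt0P[w0 _] := Om0; apply/hasP; exists w0 => //;
      exact: mem_index_enum.
  rewrite Ev -/(q w); have := lt w.
  have : 0 <= lam * q w ^+ 2.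
    by case/andP: lam01 => /ltW ? _; rewrite mulr_ge0// sqr_ge0.
  lra.
have sumc (c : R) : \sum_(w : Om) c =
    #|Om|%:R * c by rewrite sumr_const mulr_natl.
move: pot; rewrite !sumc => pot lt'.
have N0 : 0 < #|Om|%:R :> R by rewrite ltr0n.
have := le_lt_trans pot (ltr_leD lt' (lexx _)).
rewrite [n%:R * _]mulrCA -mulrDr ltr_pM2l// /lam.
move: cost_le p01 => + /andP[]; rewrite /lam; nra.
Qed.

Lemma testing_risk_gt :
  (gamma%:E < testing_risk Z X beta L n alpha f rho)%E.
Proof.
have g1 := gamma_lt1.
apply: (@lt_le_trans _ _ ((1 + gamma) / 2)%:E); first by rewrite lte_fin; lra.
apply: le_ereal_inf_tmp => _ [Q Q_ldp <-].
apply: le_ereal_inf_tmp => _ [phi _ <-].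
have [w le_w] := private_test_error phi Q_ldp.
apply: le_trans le_w _; apply: ereal_sup_ubound.
by exists (g w).
Qed.

End testing.

(** * Hoelder bumps below a density *)

Section powers.
Context (R : realType).
Implicit Types a b beta : R.

(** For c in [0, a + b] the ratio c / (a + b) is at most its power beta; the
    bounds for c = a and c = b add up to the claim. *)
Lemma powR_subadditive beta a b : 0 < beta <= 1 -> 0 <= a -> 0 <= b ->
  (a + b) `^ beta <= a `^ beta + b `^ beta.
Proof.
move=> /andP[beta0 beta1] a0 b0.
have [s0|s0] := eqVneq (a + b) 0.
  by rewrite s0 powR0 ?gt_eqF// addr_ge0 ?powR_ge0.
have s_gt0 : 0 < a + b by rewrite lt_neqAle eq_sym s0 addr_ge0.
(* Each summand takes its share c / (a + b) of the right-hand side. *)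
have part c : 0 <= c -> c <= a + b ->
    c / (a + b) * (a + b) `^ beta <= c `^ beta.
  move=> c0 cs; have [->|cn0] := eqVneq c 0.
    by rewrite !mul0r powR_ge0.
  have cE : c = c / (a + b) * (a + b) by rewrite divfK.
  have q0 : 0 < c / (a + b) by rewrite divr_gt0// lt_neqAle eq_sym cn0.
  rewrite [in leRHS]cE (powRM _ (ltW q0) (ltW s_gt0)) ler_wpM2r ?powR_ge0//.
  apply: ger1_powR => //; rewrite q0/= ler_pdivrMr// mul1r//.
rewrite -[leLHS]mul1r -(divff s0) [X in X * _]mulrDl mulrDl.
by apply: lerD; apply: part => //; rewrite ?lerDl ?lerDr.
Qed.

Lemma powR_holder beta a b : 0 < beta <= 1 -> 0 <= a -> 0 <= b ->
  `|a `^ beta - b `^ beta| <= `|a - b| `^ beta.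
Proof.
move=> beta01; wlog ab : a b / b <= a => [H|] a0 b0.
  have /orP[/H|/H] := le_total a b; last exact.
  by rewrite distrC (distrC a); exact.
have beta0 : 0 <= beta by case/andP: beta01 => /ltW.
rewrite !ger0_norm ?subr_ge0 ?ge0_ler_powR ?nnegrE// lerBlDr.
rewrite -{1}(subrK b a); apply: powR_subadditive => //.
by rewrite subr_ge0.
Qed.

End powers.

Section bumps.
Context (R : realType).
Implicit Types (s t x y : R).

(** The distance to the complement of the interval between s and t. *)
Definition tent s t x : R := Num.max 0 (Num.min (x - s) (t - x)).

Lemma tent_ge0 s t x : 0 <= tent s t x.
Proof. by rewrite /tent le_max lexx. Qed.

Lemma tent_out s t x : ~~ (s < x < t) -> tent s t x = 0.
Proof.
rewrite negb_and -!leNgt => xst; apply/max_idPl; rewrite ge_min !subr_le0.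
by case/orP: xst => ->; rewrite ?orbT.
Qed.

Lemma tent_lipschitz s t x y : `|tent s t x - tent s t y| <= `|x - y|.
Proof.
wlog xy : x y / tent s t y <= tent s t x => [H|].
  have /orP[/H|/H] := le_total (tent s t x) (tent s t y); last exact.
  by rewrite distrC (distrC x).
rewrite ger0_norm ?subr_ge0// lerBlDr {1}/tent ge_max.
rewrite addr_ge0 ?tent_ge0//=.
have : Num.min (y - s) (t - y) <= tent s t y by rewrite /tent le_max lexx orbT.
have := ler_norm (x - y); have := ler_norm (y - x); rewrite distrC.
have /orP[yE|yE] := le_total (y - s) (t - y).
  rewrite (min_idPl yE) => h1 h2 h3; rewrite ge_min; apply/orP; left; lra.
rewrite (min_idPr yE) => h1 h2 h3; rewrite ge_min; apply/orP; right; lra.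
Qed.

Lemma tent_le_dist s t x y : ~~ (s < y < t) -> tent s t x <= `|x - y|.
Proof.
move=> /(tent_out) ty; have := tent_lipschitz s t x y.
by rewrite ty subr0 ger0_norm ?tent_ge0.
Qed.

Lemma tent_ge s t x (h : R) : 0 <= h -> s + h <= x <= t - h -> h <= tent s t x.
Proof.
move=> h0 /andP[sx xt]; rewrite /tent le_max; apply/orP; right.
by rewrite le_min; apply/andP; split; lra.
Qed.

Lemma measurable_tent s t : measurable_fun setT (tent s t).
Proof.
apply: measurable_maxr => //; apply: measurable_minr.
  exact: measurable_funB.
exact: measurable_funB.
Qed.

Lemma norm_min_le (a b c d M : R) : `|a - c| <= M -> `|b - d| <= M ->
  `|Num.min a b - Num.min c d| <= M.
Proof.
rewrite !ler_norml => /andP[? ?] /andP[? ?].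
rewrite /Num.min; case: ltP => ?; case: ltP => ?; apply/andP; split; lra.
Qed.

Variables (X : set R) (f : R -> R) (beta C : R).
Hypotheses (beta01 : 0 < beta <= 1) (f0 : forall x, X x -> 0 <= f x).
Hypotheses (C2 : 2 <= C) (fC : forall x y, X x -> X y ->
  `|f x - f y| <= C * `|x - y| `^ beta).

(** Taking the minimum with f, rather than with a constant, keeps f - bump
    nonnegative on all of X: a lower bound of f is known on B only, and the cell
    between s and t may contain points of X where f vanishes. *)
Definition bump s t x : R := Num.min (f x) (tent s t x `^ beta).

Lemma bump_ge0 s t x : X x -> 0 <= bump s t x.
Proof. by move=> Xx; rewrite /bump le_min f0// powR_ge0. Qed.

Lemma bump_le s t x : bump s t x <= f x.
Proof. by rewrite /bump ge_min lexx. Qed.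

Lemma bump_out s t x : X x -> ~~ (s < x < t) -> bump s t x = 0.
Proof.
move=> Xx xst; rewrite /bump tent_out// powR0.
  by apply/min_idPr; exact: f0.
by case/andP: beta01 => b0 _; rewrite gt_eqF.
Qed.

Lemma bump_le_dist s t x y : ~~ (s < y < t) -> bump s t x <= `|x - y| `^ beta.
Proof.
move=> yst; rewrite /bump ge_min; apply/orP; right.
case/andP: beta01 => /ltW b0 _.
by rewrite ge0_ler_powR// ?nnegrE ?tent_ge0// tent_le_dist.
Qed.

Lemma bump_holder s t x y : X x -> X y ->
  `|bump s t x - bump s t y| <= C * `|x - y| `^ beta.
Proof.
move=> Xx Xy; apply: norm_min_le; first exact: fC.
apply: le_trans (powR_holder beta01 (tent_ge0 _ _ _) (tent_ge0 _ _ _)) _.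
apply: (@le_trans _ _ (`|x - y| `^ beta)).
  case/andP: beta01 => /ltW b0 _.
  by rewrite ge0_ler_powR ?nnegrE// tent_lipschitz.
have c2 := C2; rewrite ler_peMl ?powR_ge0//; lra.
Qed.

Lemma measurable_bump s t : measurable X -> measurable_fun X f ->
  measurable_fun X (bump s t).
Proof.
move=> mX mf; apply: measurable_minr => //.
apply: measurable_funTS.
exact: (measurableT_comp (measurable_powR beta) (measurable_tent s t)).
Qed.

Variables (I : finType) (s t : I -> R).
Hypothesis disj :
  forall i j x, i != j -> s i < x < t i -> ~~ (s j < x < t j).

Definition bumps (c : I -> R) x := \sum_i c i * bump (s i) (t i) x.

Lemma bumps_cell c x i : X x -> s i < x < t i ->
  bumps c x = c i * bump (s i) (t i) x.
Proof.
move=> Xx xi; rewrite /bumps (bigD1 i)//= big1 ?addr0// => j ji.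
by rewrite bump_out ?mulr0//; apply: (disj _ xi); rewrite eq_sym.
Qed.

Lemma bumps_out c x : X x -> (forall i, ~~ (s i < x < t i)) -> bumps c x = 0.
Proof. by move=> Xx xi; rewrite /bumps big1// => i _;
  rewrite bump_out ?mulr0. Qed.

Lemma norm_bumps c x : X x -> `|bumps c x| = bumps (fun i => `|c i|) x.
Proof.
move=> Xx; have [[i xi]|/forallNP no] := pselect (exists i, s i < x < t i).
  by rewrite !(bumps_cell _ Xx xi) normrM (ger0_norm (bump_ge0 (s i) (t i) Xx)).
have out i : ~~ (s i < x < t i) by exact/negP/no.
by rewrite !bumps_out// normr0.
Qed.

Lemma bumps_le c x : X x -> (forall i, `|c i| <= 1) -> `|bumps c x| <= f x.
Proof.
move=> Xx c1; have [[i xi]|/forallNP no] := pselect (exists i, s i < x < t i).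
  rewrite (bumps_cell _ Xx xi) normrM (ger0_norm (bump_ge0 (s i) (t i) Xx))//.
  by apply: le_trans (bump_le (s i) (t i) x); rewrite ler_piMl ?bump_ge0.
by rewrite bumps_out ?normr0 ?f0// => i; exact/negP/no.
Qed.

(** Two points of one cell are controlled by a single bump.  Otherwise each of
    the two values is at most the distance to the other point, to the power
    beta; this is where 2 <= C comes from. *)
Lemma bumps_holder c x y : X x -> X y -> (forall i, `|c i| <= 1) ->
  `|bumps c x - bumps c y| <= C * `|x - y| `^ beta.
Proof.
move=> Xx Xy c1.
have [[i [xi yi]]|/forallNP no] :=
    pselect (exists i, (s i < x < t i) /\ (s i < y < t i)).
  rewrite (bumps_cell _ Xx xi) (bumps_cell _ Xy yi) -mulrBr normrM.
  by apply: le_trans (bump_holder (s i) (t i) Xx Xy); rewrite ler_piMl.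
have side u v : X u -> (forall i, (s i < u < t i) -> ~~ (s i < v < t i)) ->
    `|bumps c u| <= `|u - v| `^ beta.
  move=> Xu uv;
    have [[i ui]|/forallNP no'] := pselect (exists i, s i < u < t i).
    rewrite (bumps_cell _ Xu ui) normrM (ger0_norm (bump_ge0 (s i) (t i) Xu))//.
    apply: le_trans (bump_le_dist u (uv i ui)).
    by rewrite ler_piMl ?bump_ge0.
  by rewrite bumps_out ?normr0 ?powR_ge0// => i; exact/negP/no'.
have hx := side x y Xx (fun i xi => introN idP (fun yi => no i (conj xi yi))).
have hy := side y x Xy (fun i yi => introN idP (fun xi => no i (conj xi yi))).
rewrite distrC in hy.
apply: le_trans (ler_normB _ _) _; apply: le_trans (lerD hx hy) _.
by rewrite -mulr2n -mulr_natl ler_wpM2r ?powR_ge0.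
Qed.

End bumps.

(** * Cells of equal mass *)

Section cells.
Context (R : realType).
Local Notation leb := (@lebesgue_measure R).
Variables (B : set R) (A M : R).
Hypotheses (mB : measurable B) (A0 : 0 <= A) (BA : B `<=` `[- A, A]).
Hypotheses (MB : leb B = M%:E) (M0 : 0 < M).

Let F x := fine (leb (B `&` `]-oo, x])).

Let mBI (D : set R) : measurable D -> measurable (B `&` D).
Proof. exact: measurableI. Qed.

Let finB (D : set R) : measurable D -> leb (B `&` D) \is a fin_num.
Proof.
move=> mD; rewrite ge0_fin_numE//; apply: (@le_lt_trans _ _ (leb B)).
  by apply: le_measure; rewrite ?inE; [exact: mBI|exact: mB|exact: subIsetl].
by rewrite MB ltry.
Qed.

Let massE a b : a <= b -> F b - F a = fine (leb (B `&` `]a, b])).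
Proof.
move=> ab; apply/eqP; rewrite subr_eq; apply/eqP.
rewrite /F -fineD ?finB//; congr fine.
rewrite -measureU//; [|exact: mBI|exact: mBI|].
  congr (leb _); rewrite -setIUr; congr (_ `&` _).
  apply/seteqP; split => x /=; rewrite !in_itv/=.
    by move=> xb; case: (leP x a) => xa; [right|left; rewrite xb].
  by case=> [/andP[]//|xa]; exact: le_trans xa ab.
apply/seteqP; split => x //= [[_]]; rewrite !in_itv/= => /andP[ax _] [_].
by rewrite leNgt ax.
Qed.

Let F_lip a b : a <= b -> 0 <= F b - F a <= b - a.
Proof.
move=> ab; rewrite massE// fine_ge0//= -lee_fin fineK ?finB//.
apply: (@le_trans _ _ (leb `]a, b])).
  by apply: le_measure; rewrite ?inE;
    [exact: mBI|exact: measurable_itv|exact: subIsetr].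
rewrite lebesgue_measure_itv/= lte_fin; case: ltP => // _.
by rewrite lee_fin subr_ge0.
Qed.

Let F_continuous : continuous F.
Proof.
move=> x; apply/cvgrPdist_lt => e e0; near=> y.
apply: (@le_lt_trans _ _ `|x - y|).
  have [xy|/ltW yx] := leP x y.
    have /andP[h1 h2] := F_lip xy.
    by rewrite distrC (distrC x) !ger0_norm// subr_ge0.
  have /andP[h1 h2] := F_lip yx.
  by rewrite !ger0_norm// subr_ge0.
near: y; exact: (nbhsx_ballx x (PosNum e0)%:num e0).
Unshelve. all: by end_near. Qed.

Let F_lo : F (- A - 1) = 0.
Proof.
rewrite /F (_ : B `&` _ = set0) ?measure0// -subset0 => x [/BA] /=.
by rewrite !in_itv/= => /andP[h _] h'; lra.
Qed.

Let F_hi : F A = M.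
Proof.
rewrite /F (_ : B `&` _ = B) ?MB//; apply/setIidPl => x /BA /=.
by rewrite !in_itv/= => /andP[].
Qed.

(** The distribution function of the measure restricted to B is 1-Lipschitz,
    so it takes the values k m by the intermediate value theorem, and moving
    both ends of a cell inwards by m / 4 loses at most half of the mass m.  B
    need not be an interval: only its mass is cut into equal parts. *)
Lemma equal_mass_cells (I : finType) (m : R) :
  (0 < #|I|)%N -> m = M / #|I|%:R -> exists s t : I -> R,
  (forall i j (x : R), i != j -> s i < x < t i -> ~~ (s j < x < t j)) /\
  (forall i, ((m / 2)%:E <= leb (B `&` `[(s i + m / 4)%R, (t i - m / 4)%R]))%E).
Proof.
move=> I0 mE; set K := #|I|.
have K0 : 0 < K%:R :> R by rewrite ltr0n.
have m0 : 0 < m by rewrite mE divr_gt0.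
have lev k : exists c, (k <= K)%N -> F c = k%:R * m.
  have [kK|Kk] := leqP k K; last by exists 0.
  have [|||c _ <-] := @IVT R F (- A - 1) A (k%:R * m); last by exists c.
  - have h := A0; lra.
  - exact: continuous_subspaceT.
  - rewrite F_lo F_hi (min_idPl (ltW M0)) (max_idPr (ltW M0)).
    rewrite mulr_ge0 ?(ltW m0)//= mE mulrA ler_pdivrMr//.
    by rewrite mulrC ler_pM2l// ler_nat.
have [r rE] := choice lev.
have r_mono a b : (a <= b <= K)%N -> r a <= r b.
  move=> /andP[]; rewrite leq_eqVlt => /predU1P[->//|ab] bK.
  rewrite leNgt; apply/negP => /ltW/F_lip/andP[+ _].
  rewrite !rE ?(leq_trans (ltnW ab))// -mulrBl pmulr_lge0// subr_ge0 ler_nat.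
  by rewrite leqNgt ab.
exists (fun i => r (enum_rank i)), (fun i => r (enum_rank i).+1); split.
  have key (i j : I) x : (enum_rank i < enum_rank j)%N ->
      x < r (enum_rank i).+1 -> r (enum_rank j) < x -> False.
    move=> ij xi xj; have := r_mono (enum_rank i).+1 (enum_rank j).
    by rewrite ij /= (ltnW (ltn_ord (enum_rank j))) => /(_ isT);
      rewrite leNgt (lt_trans xj xi).
  move=> i j x ij /andP[ix xi]; apply/negP => /andP[jx xj].
  have : (enum_rank i : nat) != enum_rank j.
    by apply: contra ij => /eqP/val_inj/enum_rank_inj ->.
  by rewrite neq_ltn => /orP[h|h]; [exact: (key i j x)|exact: (key j i x)].
move=> i; set s := r _; set t := r _.
have Fst : F t - F s = m by rewrite !rE ?(ltnW (ltn_ord _))// -mulrBl -natrB//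
    subSnn mul1r.
have st : s <= t by apply: r_mono; rewrite leqnSn ltn_ord.
have /andP[_ mst] := F_lip st; rewrite Fst in mst.
have ab : s + m / 4 <= t - m / 4 by lra.
apply: (@le_trans _ _ (leb (B `&` `]s + m / 4, t - m / 4]))); last first.
  apply: le_measure; rewrite ?inE; [exact: mBI|exact: mBI|].
  apply: setIS => x /=; rewrite !in_itv/= => /andP[/ltW -> ->]//.
rewrite -[leRHS]fineK ?finB// lee_fin -massE//.
have sm : s <= s + m / 4 by lra.
have mt : t - m / 4 <= t by lra.
have /andP[_ h1] := F_lip sm; have /andP[_ h2] := F_lip mt; lra.
Qed.

End cells.

(** * The binned alternatives *)

(** Flipping the j-th sign is an involution that changes the sign of the sum
    when j and k differ. *)
Lemma rademacher_orthogonal (R : realFieldType) (J : finType) (j k : J) :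
  \sum_(w : {ffun J -> bool}) (-1) ^+ w j * (-1) ^+ w k =
  (j == k)%:R * #|{ffun J -> bool}|%:R :> R.
Proof.
have [<-|jk] := eqVneq j k.
  rewrite mul1r (eq_bigr (fun=> 1)) ?sumr_const// => w _.
  by rewrite -expr2 sqrr_sign.
rewrite mul0r; set S := \sum_w _.
pose flip (w : {ffun J -> bool}) := [ffun i => if i == j then ~~ w i else w i].
have flipK : involutive flip.
  by move=> w; apply/ffunP => i; rewrite !ffunE; case: (i == j); rewrite ?negbK.
have SN : S = - S.
  rewrite {1}/S (reindex_inj (inv_inj flipK))/= -sumrN.
  apply: eq_bigr => w _; rewrite !ffunE eqxx eq_sym (negbTE jk).
  by rewrite signrN mulNr.
by lra.
Qed.

Section binned.
Context (R : realType) (X : set R) (mX : measurable X).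
Local Notation leb := (@lebesgue_measure R).
Variables (beta L L0 C eps : R) (f : R -> R).
Hypotheses (beta01 : 0 < beta <= 1) (df : prob_density X f).
Hypotheses (hf : holder_class X beta L0 f) (C2 : 2 <= C) (L0C : L0 <= C).
Hypotheses (eps0 : 0 < eps) (eps1 : eps <= 1) (epsL : L0 + eps * C <= L).

Let f0 x : X x -> 0 <= f x. Proof. by case: df => _ + _; exact. Qed.
Let mf : measurable_fun X f. Proof. by case: df. Qed.
Let If := prob_density_integrable df.
Let fL0 x y : X x -> X y -> `|f x - f y| <= L0 * `|x - y| `^ beta.
Proof. by case: hf => _; exact. Qed.
Let fC x y : X x -> X y -> `|f x - f y| <= C * `|x - y| `^ beta.
Proof.
move=> Xx Xy; apply: le_trans (fL0 Xx Xy) _.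
by rewrite ler_wpM2r ?powR_ge0.
Qed.

Let integrable_bump s t : leb.-integrable X (EFin \o bump f beta s t).
Proof.
apply: (@le_integrable _ _ _ leb X mX _ (EFin \o f)) => //.
  by apply/measurable_EFinP; exact: measurable_bump.
move=> x Xx /=; rewrite lee_fin (ger0_norm (f0 Xx)).
by rewrite (ger0_norm (bump_ge0 beta f0 s t Xx)) bump_le.
Qed.

(** On the part of B at distance m / 4 from the ends of the cell, f is at least
    C0 and the tent is at least m / 4. *)
Lemma bump_mass (B : set R) (C0 m s t : R) : measurable B -> B `<=` X ->
  0 <= C0 -> (forall x, B x -> C0 <= f x) -> 0 < m ->
  ((m / 2)%:E <= leb (B `&` `[(s + m / 4)%R, (t - m / 4)%R]))%E ->
  m / 2 * Num.min C0 ((m / 4) `^ beta) <=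
    \int[leb]_(x in X) bump f beta s t x.
Proof.
move=> mB BX C00 fB m0 mass; set D := _ `&` _ in mass.
have mD : measurable D by exact: measurableI.
set h := Num.min _ _.
have h0 : 0 <= h by rewrite le_min C00 powR_ge0.
rewrite -lee_fin /Rintegral fineK; last first.
  exact: (@integrable_fin_num _ _ _ leb X mX _ (integrable_bump s t)).
apply: (@le_trans _ _ (\int[leb]_(x in D) h%:E)%E).
  rewrite integral_cst// EFinM muleC lee_wpmul2l ?lee_fin//.
apply: (@le_trans _ _ (\int[leb]_(x in D) (bump f beta s t x)%:E)%E).
  apply: ge0_le_integral => //.
  - apply/measurable_EFinP; apply: (measurable_funS mX) => //.
      by move=> x [/BX].
    exact: measurable_bump.
  - move=> x [Bx];
    rewrite /= in_itv/= => /tent_ge => /(_ (divr_ge0 (ltW m0) (ler0n _ 4))) xt.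
    rewrite lee_fin /bump /h le_min !ge_min fB//=.
    case/andP: beta01 => /ltW b0 _.
    apply/orP; right.
    by rewrite ge0_ler_powR// ?nnegrE ?tent_ge0// divr_ge0 ?ltW.
apply: ge0_subset_integral => //.
- by apply/measurable_EFinP; exact: measurable_bump.
- by move=> x Xx; rewrite lee_fin; exact: (bump_ge0 beta f0).
- by move=> x [/BX].
Qed.

Variables (N : nat) (s t : 'I_N * bool -> R) (q : R).
Hypothesis disj : forall i j (x : R), i != j ->
  s i < x < t i -> ~~ (s j < x < t j).
Let p i := \int[leb]_(x in X) bump f beta (s i) (t i) x.
Hypotheses (q0 : 0 < q) (qp : forall i, q <= p i).

Let p0 i : 0 < p i. Proof. exact: lt_le_trans q0 (qp i). Qed.

Let c i := (-1) ^+ (i.2 : bool) * (q / p i).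

Let qpE i : q / p i * p i = q.
Proof. by rewrite divfK// gt_eqF. Qed.

Let cp i : c i * p i = (-1) ^+ (i.2 : bool) * q.
Proof. by rewrite /c -mulrA qpE. Qed.

Let normc i : `|c i| = q / p i.
Proof. by rewrite /c normrM normrX normrN1 expr1n mul1r ger0_norm//
    divr_ge0 ?ltW. Qed.

(** The two bumps of bin j are rescaled to the same mass q and enter with
    opposite signs, so that the mass of the density is preserved whatever the
    sign given to the bin. *)
Definition bin_perturbation j x := eps *
  \sum_(b : bool) c (j, b) * bump f beta (s (j, b)) (t (j, b)) x.

Definition perturbed_density (w : {ffun 'I_N -> bool}) x :=
  f x + \sum_j (-1) ^+ w j * bin_perturbation j x.

Let cw (w : {ffun 'I_N -> bool}) i := (-1) ^+ w i.1 * c i.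

Let normcw w i : `|cw w i| = q / p i.
Proof. by rewrite /cw normrM normc normrX normrN1 expr1n mul1r. Qed.

(** The perturbation is also a single sum of bumps over all cells, the form in
    which the disjointness of the cells is used. *)
Let perturbedE w x : perturbed_density w x =
    f x + eps * bumps f beta s t (cw w) x.
Proof.
rewrite /perturbed_density; congr (_ + _); rewrite /bumps mulr_sumr.
rewrite (eq_bigr (fun i => eps * (cw w (i.1, i.2) *
   bump f beta (s (i.1, i.2)) (t (i.1, i.2)) x))); last by move=> [].
rewrite -(pair_bigA _ (fun j b => eps * (cw w (j, b) *
   bump f beta (s (j, b)) (t (j, b)) x)))/=.
apply: eq_bigr => j _; rewrite /bin_perturbation !mulr_sumr.
by apply: eq_bigr => b _; rewrite /cw/=; ring.
Qed.

Let integral_sum (I : finType) (k : I -> R) (u : I -> R -> R) :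
  (forall i, leb.-integrable X (EFin \o u i)) ->
  leb.-integrable X (EFin \o (fun x => \sum_i k i * u i x)) /\
  \int[leb]_(x in X) (\sum_i k i * u i x) =
  \sum_i k i * \int[leb]_(x in X) u i x.
Proof.
move=> iu; elim: (index_enum I) => [|i r [ir IH]].
  rewrite big_nil; split.
    have := @integrableZl _ _ _ leb X mX 0 _ If;
      apply: eq_integrable => //= x _.
    by rewrite big_nil mul0e.
  by under eq_Rintegral do rewrite big_nil; rewrite Rintegral_cst// mul0r.
have ii : leb.-integrable X (EFin \o (fun x => k i * u i x)).
  by have := @integrableZl _ _ _ leb X mX (k i) _ (iu i); apply: eq_integrable.
split.
  have := @integrableD _ _ _ leb X mX _ _ ii ir;
    apply: eq_integrable => //= x _.
  by rewrite big_cons.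
under eq_Rintegral do rewrite big_cons.
by rewrite RintegralD// RintegralZl// IH big_cons.
Qed.

Lemma bin_perturbation_integrable j :
  leb.-integrable X (EFin \o bin_perturbation j).
Proof.
have [ij _] := integral_sum (fun b => c (j, b))
    (fun b => integrable_bump (s (j, b)) (t (j, b))).
by have := @integrableZl _ _ _ leb X mX eps _ ij; apply: eq_integrable.
Qed.

Lemma bin_perturbation0 j : \int[leb]_(x in X) bin_perturbation j x = 0.
Proof.
have [ij ijE] := integral_sum (fun b => c (j, b))
    (fun b => integrable_bump (s (j, b)) (t (j, b))).
transitivity (eps * \sum_(b : bool) c (j, b) * p (j, b)).
  by rewrite RintegralZl// ijE.
rewrite (eq_bigr (fun b : bool => (-1) ^+ b * q)); last first.
  by move=> b _; exact: cp.
by rewrite big_bool /=; ring.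
Qed.

Lemma bin_perturbation_norm j :
  \int[leb]_(x in X) `|bin_perturbation j x| <= eps * (2 * q).
Proof.
have [ij ijE] := integral_sum (fun b => q / p (j, b))
  (fun b => integrable_bump (s (j, b)) (t (j, b))).
apply: (@le_trans _ _ (\int[leb]_(x in X) (eps * \sum_(b : bool) q / p (j, b) *
    bump f beta (s (j, b)) (t (j, b)) x))).
  apply: le_Rintegral => //.
  - by have := integrable_norm (bin_perturbation_integrable j);
    apply: eq_integrable.
  - by have := @integrableZl _ _ _ leb X mX eps _ ij; apply: eq_integrable.
  - move=> x Xx; rewrite normrM (gtr0_norm eps0); apply: (ler_wpM2l (ltW eps0)).
    apply: le_trans (ler_norm_sum _ _ _) _; apply: ler_sum => b _.
    by rewrite normrM normc (ger0_norm (bump_ge0 _ f0 _ _ Xx)).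
have -> : eps * (2 * q) = eps * \sum_(b : bool) q / p (j, b) * p (j, b).
  by rewrite (eq_bigr (fun=> q)) ?big_bool ?mulr2n ?mulrDl ?mul1r.
by rewrite RintegralZl// ijE.
Qed.

Let c1 w i : `|cw w i| <= 1.
Proof. by rewrite normcw ler_pdivrMr// mul1r. Qed.

Lemma perturbed_density_alternative w :
  alternatives X beta L f (N%:R * (eps * (2 * q))) (perturbed_density w).
Proof.
have hL x : X x -> `|bumps f beta s t (cw w) x| <= f x.
  by move=> Xx; apply: (bumps_le beta01 f0 disj).
have g0 x : X x -> 0 <= perturbed_density w x.
  move=> Xx; rewrite perturbedE; have := hL x Xx;
    rewrite ler_norml => /andP[h1 h2].
  have e0 := eps0; have e1 := eps1; have fx := f0 Xx; nra.
have ih := (integral_sum (fun j => (-1) ^+ w j) bin_perturbation_integrable).1.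
have ig : leb.-integrable X (EFin \o perturbed_density w).
  by have := @integrableD _ _ _ leb X mX _ _ If ih; apply: eq_integrable.
split.
- split => //.
    by apply/measurable_EFinP; case/integrableP: ig.
  rewrite -[LHS]fineK; last exact: integrable_fin_num.
  congr EFin;
    rewrite -/(Rintegral _ _ _) RintegralD// (prob_density_Rintegral df).
  rewrite (integral_sum _ bin_perturbation_integrable).2 big1 ?addr0// => j _.
  by rewrite bin_perturbation0 mulr0.
- split => // x y Xx Xy; rewrite !perturbedE.
  have := bumps_holder beta01 f0 C2 fC disj Xx Xy (c1 w).
  set u := bumps _ _ _ _ _ x; set v := bumps _ _ _ _ _ y => uv.
  rewrite (_ : _ - _ = (f x - f y) + eps * (u - v)); last by ring.
  apply: le_trans (ler_normD _ _) _; rewrite normrM (gtr0_norm eps0).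
  apply: le_trans (lerD (fL0 Xx Xy) (ler_wpM2l (ltW eps0) uv)) _.
  by rewrite mulrA -mulrDl ler_wpM2r ?powR_ge0.
- rewrite /L1_dist.
  have [ib ibE] := integral_sum (fun i => q / p i)
      (fun i => integrable_bump (s i) (t i)).
  have -> : (\int[leb]_(x in X) `|perturbed_density w x - f x|%:E =
    \int[leb]_(x in X) (eps * \sum_i q / p i * bump f beta (s i) (t i) x)%:E)%E.
    apply: eq_integral => x /[!inE] Xx.
    rewrite perturbedE addrC addKr normrM (gtr0_norm eps0).
    rewrite (norm_bumps beta01 f0 disj)//.
    by congr (_ * _)%:E; apply: eq_bigr => i _; rewrite normcw.
  have ib' : leb.-integrable X (EFin \o (fun x =>
      eps * \sum_i q / p i * bump f beta (s i) (t i) x)).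
    by have := @integrableZl _ _ _ leb X mX eps _ ib; apply: eq_integrable.
  rewrite -[leRHS]fineK; last exact: integrable_fin_num.
  rewrite lee_fin -/(Rintegral _ _ _) RintegralZl// ibE.
  rewrite (eq_bigr (fun=> q)); last by move=> i _; exact: qpE.
  rewrite sumr_const card_prod card_ord card_bool -[q *+ _]mulr_natl natrM.
  by rewrite le_eqVlt; apply/orP; left; apply/eqP; ring.
Qed.

End binned.

(** * The risk against the two families *)

Section risk_bounds.
Context (R : realType) (d : measure_display) (Z : measurableType d).
Context (X : set R) (mX : measurable X) (n : nat).
Variables (beta L L0 alpha gamma rho : R) (f : R -> R).
Hypotheses (alpha_ge0 : 0 <= alpha) (gamma_lt1 : gamma < 1)
    (gamma_gt0 : 0 < gamma).
Hypotheses (beta01 : 0 < beta <= 1) (df : prob_density X f).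
Hypotheses (hf : holder_class X beta L0 f).
Hypothesis rho_gt0 : 0 < rho.

(** The 2 N cells have mass m, and each of the N perturbations has L1 norm
    rho / N, so that n sum_j kappa_j^2 = n (e^alpha - 1)^2 rho^2 / N. *)
Lemma binned_testing_risk (B : set R) (A M C C0 eps m : R) (N : nat) :
  2 <= C -> L0 <= C -> 0 < eps -> eps <= 1 -> L0 + eps * C <= L ->
  measurable B -> 0 <= A -> B `<=` `[- A, A] -> B `<=` X ->
  lebesgue_measure B = M%:E -> 0 < M ->
  0 < C0 -> (forall x, B x -> C0 <= f x) ->
  (0 < N)%N -> m = M / (2 * N%:R) ->
  rho <= eps * (M / 2) * Num.min C0 ((m / 4) `^ beta) ->
  n%:R * ((expR alpha - 1) * rho) ^+ 2 / N%:R <= (1 - gamma) ^+ 2 / 4 ->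
  (gamma%:E < testing_risk Z X beta L n alpha f rho)%E.
Proof.
move=> C2 L0C eps0 eps1 epsL mB A0 BA BX MB M0 C00 fB N0 mE rho_le info.
have NR : 0 < N%:R :> R by rewrite ltr0n.
have I0 : (0 < #|{: 'I_N * bool}|)%N
    by rewrite card_prod card_ord card_bool muln_gt0 N0.
have mI : m = M / #|{: 'I_N * bool}|%:R.
  by rewrite mE card_prod card_ord card_bool natrM mulrC [in RHS]mulrC [N%:R * _]mulrC.
have m0 : 0 < m by rewrite mE divr_gt0// mulr_gt0.
have [s [t [disj mass]]] := equal_mass_cells mB A0 BA MB M0 I0 mI.
pose q := rho / (2 * N%:R * eps).
have q0 : 0 < q by rewrite divr_gt0// !mulr_gt0.
have qE : eps * (2 * q) = rho / N%:R.
  by rewrite /q; field; rewrite !gt_eqF.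
have qp i : q <= \int[lebesgue_measure]_(x in X) bump f beta (s i) (t i) x.
  apply: le_trans (bump_mass mX beta01 df mB BX (ltW C00) fB m0 (mass i)).
  rewrite /q ler_pdivrMr ?mulr_gt0//; apply: le_trans rho_le _.
  rewrite le_eqVlt; apply/orP; left; apply/eqP; rewrite mE.
  by field; rewrite gt_eqF.
have rhoE : rho = N%:R * (eps * (2 * q)) by rewrite qE mulrC divfK// gt_eqF.
apply: (@testing_risk_gt _ _ _ _ mX _ _ _ _ _ _ alpha_ge0 gamma_lt1 gamma_gt0 _ df
  {ffun 'I_N -> bool} 'I_N (fun j w => (-1) ^+ w j) _ _
  (bin_perturbation X beta eps f s t q) (fun=> rho / N%:R) _ _ _
  (perturbed_density X beta eps f s t q)).
- by apply/card_gt0P; exists [ffun=> true].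
- by move=> j k; exact: rademacher_orthogonal.
- by move=> j; exact: (bin_perturbation_integrable mX beta eps df).
- by move=> j; exact: (bin_perturbation0 mX eps df q0 qp).
- by move=> j; rewrite -qE; exact: (bin_perturbation_norm mX df eps0 q0 qp).
- move=> w; rewrite {1}rhoE.
  exact: (perturbed_density_alternative mX beta01 df hf C2 L0C eps0 eps1 epsL disj q0 qp).
- by [].
- apply: le_trans info; rewrite sumr_const card_ord -[_ *+ N]mulr_natl.
  rewrite le_eqVlt; apply/orP; left; apply/eqP; field; by rewrite gt_eqF.
Qed.

(** A family with one member: Bessel's inequality is then an equality, and the
    only perturbation rho (h - f) has L1 norm at most 2 rho. *)
Lemma mixture_testing_risk (h : R -> R) (Lh : R) :
  prob_density X h -> holder_class X beta Lh h -> (1 <= L1_dist X h f)%E ->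
  rho <= 1 -> (1 - rho) * L0 + rho * Lh <= L ->
  n%:R * ((expR alpha - 1) * (2 * rho)) ^+ 2 <= (1 - gamma) ^+ 2 / 4 ->
  (gamma%:E < testing_risk Z X beta L n alpha f rho)%E.
Proof.
move=> dh hh far rho1 holL info.
have If := prob_density_integrable df; have Ih := prob_density_integrable dh.
pose leb := @lebesgue_measure R.
have [mf f0 f1] := df; have [mh h0 h1] := dh.
pose psi x := rho * (h x - f x).
have ihf : leb.-integrable X (EFin \o (fun x => h x - f x)).
  by have := @integrableB _ _ _ leb X mX _ _ Ih If; apply: eq_integrable.
have ipsi : leb.-integrable X (EFin \o psi).
  by have := @integrableZl _ _ _ leb X mX rho _ ihf; apply: eq_integrable.
have psi0 : \int[leb]_(x in X) psi x = 0.
  rewrite RintegralZl// RintegralB// (prob_density_Rintegral dh).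
  by rewrite (prob_density_Rintegral df) subrr mulr0.
pose g x := f x + psi x.
have gE x : g x = (1 - rho) * f x + rho * h x by rewrite /g /psi; ring.
have ig : leb.-integrable X (EFin \o g).
  by have := @integrableD _ _ _ leb X mX _ _ If ipsi; apply: eq_integrable.
have r1 : 0 <= 1 - rho by rewrite subr_ge0.
have g0 x : X x -> 0 <= g x.
  by move=> Xx; rewrite gE addr_ge0// mulr_ge0 ?f0 ?h0// ltW.
apply: (@testing_risk_gt _ _ _ _ mX _ _ _ _ _ _ alpha_ge0 gamma_lt1 gamma_gt0 _ df
  unit unit (fun _ _ => 1) _ _ (fun=> psi) (fun=> 2 * rho) _ _ _ (fun=> g)).
- by rewrite card_unit.
- by move=> [] []; rewrite sumr_const card_unit eqxx !mulr1.
- by [].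
- by [].
- move=> _; apply: (@le_trans _ _ (\int[leb]_(x in X) (rho * (h x + f x)))).
    have ihf' : leb.-integrable X (EFin \o (fun x => h x + f x)).
      by have := @integrableD _ _ _ leb X mX _ _ Ih If; apply: eq_integrable.
    apply: le_Rintegral => //.
    + by have := integrable_norm ipsi; apply: eq_integrable.
    + by have := @integrableZl _ _ _ leb X mX rho _ ihf'; apply: eq_integrable.
    + move=> x Xx; rewrite /psi normrM (gtr0_norm rho_gt0).
      apply: (ler_wpM2l (ltW rho_gt0)); apply: le_trans (ler_normB _ _) _.
      by rewrite !ger0_norm ?f0 ?h0.
  rewrite RintegralZl//; last first.
    by have := @integrableD _ _ _ leb X mX _ _ Ih If; apply: eq_integrable.
  rewrite RintegralD// (prob_density_Rintegral dh) (prob_density_Rintegral df).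
  by rewrite mulrC.
- move=> _; split.
  + split => //; first by apply/measurable_EFinP; case/integrableP: ig.
    rewrite -[LHS]fineK; last exact: (@integrable_fin_num _ _ _ leb X mX _ ig).
    congr EFin; rewrite -/(Rintegral _ _ _) RintegralD// psi0 addr0.
    exact: prob_density_Rintegral.
  + split => // x y Xx Xy; rewrite !gE.
    have := hf.2 x y Xx Xy; have := hh.2 x y Xx Xy => hxy fxy.
    rewrite (_ : _ - _ = (1 - rho) * (f x - f y) + rho * (h x - h y));
      last by ring.
    apply: le_trans (ler_normD _ _) _;
      rewrite !normrM (gtr0_norm rho_gt0) (ger0_norm r1).
    apply: le_trans (lerD (ler_wpM2l r1 fxy) (ler_wpM2l (ltW rho_gt0) hxy)) _.
    by rewrite !mulrA -mulrDl ler_wpM2r ?powR_ge0.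
  + rewrite /L1_dist (_ : (\int[leb]_(x in X) _)%E =
        (\int[leb]_(x in X) (rho%:E * `|h x - f x|%:E))%E); last first.
      apply: eq_integral => x _.
      by rewrite /g addrC addKr /psi normrM (gtr0_norm rho_gt0) EFinM.
    rewrite (ge0_integralZl_EFin _ _ _ _ (ltW rho_gt0))//; last first.
      by apply/measurable_EFinP; apply: measurableT_comp => //;
        exact: measurable_funB.
    apply: (@le_trans _ _ (rho%:E * 1)%E); first by rewrite mule1.
    by apply: lee_wpmul2l => //; rewrite lee_fin ltW.
- by move=> w x _; rewrite sumr_const card_unit mul1r.
- by rewrite sumr_const card_unit.
Qed.

End risk_bounds.

(** * Two densities with disjoint supports *)

Section separated.
Context (R : realType) (X : set R) (mX : measurable X).
Local Notation leb := (@lebesgue_measure R).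

Lemma exists_bounded_part : (0 < leb X)%E ->
  exists A M : R, [/\ 0 <= A, 0 < M & leb (X `&` `[- A, A]) = M%:E].
Proof.
move=> X0; apply: contrapT => none.
pose Xk (k : nat) := X `&` `[- (k%:R : R), k%:R].
have zero (k : nat) : leb (Xk k) = 0%E.
  apply/eqP; rewrite eq_le measure_ge0 andbT leNgt; apply/negP => pos.
  have fin : leb (Xk k) \is a fin_num.
    have le_itv : (leb (Xk k) <= leb [set` `[- (k%:R : R), k%:R]%R])%E.
      by apply: le_measure; rewrite ?inE;
        [exact: measurableI|exact: measurable_itv|exact: subIsetr].
    rewrite ge0_fin_numE//; apply: le_lt_trans le_itv _.
    by rewrite lebesgue_measure_itv/=; case: ifP => // _; rewrite -EFinD ltry.
  apply: none; exists k%:R, (fine (leb (Xk k))); split => //.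
    by rewrite -lte_fin fineK//; exact: pos.
  by rewrite fineK.
have : (leb X <= \sum_(k <oo) leb (Xk k))%E.
  apply: measure_sigma_subadditive => //.
    by move=> k; apply: measurableI => //; exact: measurable_itv.
  move=> x Xx; exists (Num.Def.archi_bound `|x|) => //; split => //=.
  by rewrite in_itv/= -ler_norml ltW// archi_boundP.
by rewrite eseries0 ?leNgt ?X0// => k _ _; rewrite zero.
Qed.

Let D (s t : R) := `|t - s|.

Let tent_bound s t x : tent s t x <= D s t.
Proof.
have [/andP[sx xt]|xst] := boolP (s < x < t);
  last by rewrite tent_out// normr_ge0.
apply: le_trans (tent_le_dist x (_ : ~~ (s < s < t))) _; first by rewrite ltxx.
by rewrite /D !ger0_norm ?subr_ge0; lra.
Qed.

(** Close points use that the tent is 1-Lipschitz, distant ones that it is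
    bounded; the constant is the same for all beta. *)
Lemma tent_holder (beta s t x y : R) : 0 < beta <= 1 ->
  `|tent s t x - tent s t y| <= (1 + `|t - s|) * `|x - y| `^ beta.
Proof.
move=> /andP[b0 b1]; have [->|xy] := eqVneq x y.
  by rewrite subrr normr0 mulr_ge0 ?powR_ge0 ?addr_ge0.
have d0 : 0 < `|x - y| by rewrite normr_gt0 subr_eq0.
have p0 := powR_ge0 `|x - y| beta.
have [d1|d1] := leP `|x - y| 1.
  apply: le_trans (tent_lipschitz s t x y) _.
  have : `|x - y| <= `|x - y| `^ beta by apply: ger1_powR => //; rewrite d0.
  by move=> /le_trans; apply; rewrite ler_peMl// lerDl.
have p1 : 1 <= `|x - y| `^ beta.
  by rewrite -(powRr0 `|x - y|); apply: ler_powR; exact: ltW.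
apply: (@le_trans _ _ (D s t)).
  rewrite ler_norml; have := tent_bound s t x; have := tent_bound s t y.
  have := tent_ge0 s t x; have := tent_ge0 s t y.
  by move=> *; apply/andP; split; lra.
rewrite -[leLHS]mulr1; apply: ler_pM => //; first exact: normr_ge0.
by rewrite /D lerDr.
Qed.

Let integrable_tent s t : leb.-integrable X (EFin \o tent s t).
Proof.
pose u x := D s t * \1_(`[s, t]%classic) x.
have iu : leb.-integrable X (EFin \o u).
  apply: (@integrableS _ _ _ leb setT X) => //.
  have := @integrableZl _ _ _ leb setT measurableT (D s t)
      _ (integrable_indic_itv s t true false).
  by apply: eq_integrable.
apply: (@le_integrable _ _ _ leb X mX _ (EFin \o u)) => //.
  by apply/measurable_EFinP; apply: measurable_funTS; exact: measurable_tent.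
move=> x Xx /=; rewrite lee_fin (ger0_norm (tent_ge0 s t x)) /u indicE.
have [/andP[sx xt]|xst] := boolP (s < x < t); last by rewrite tent_out.
rewrite mem_set/=; first by rewrite mulr1 ger0_norm ?tent_bound// normr_ge0.
by rewrite in_itv/= !ltW.
Qed.

(** Normalised tents over two cells that halve the mass of a bounded part of
    X.  Only X enters, so K is available before f0 and beta are chosen. *)
Lemma exists_separated_densities : (0 < leb X)%E ->
  exists (K : R) (g : bool -> R -> R),
  [/\ 0 <= K, forall b, prob_density X (g b),
      forall b beta, 0 < beta <= 1 -> holder_class X beta K (g b)
    & forall x, X x -> g true x * g false x = 0].
Proof.
move=> /exists_bounded_part[A [M [A0 M0 MB]]].
set B := X `&` _ in MB.
have mB : measurable B by apply: measurableI => //; exact: measurable_itv.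
have BA : B `<=` `[- A, A] by move=> x [].
have I0 : (0 < #|{: bool}|)%N by rewrite card_bool.
have mE : M / 2 = M / #|{: bool}|%:R by rewrite card_bool.
have [s [t [disj mass]]] := equal_mass_cells mB A0 BA MB M0 I0 mE.
set m := M / 2 in mE mass; have m0 : 0 < m by rewrite divr_gt0.
pose T b := \int[leb]_(x in X) tent (s b) (t b) x.
have T0 b : 0 < T b.
  apply: (@lt_le_trans _ _ (m / 4 * (m / 2)));
    first by rewrite !mulr_gt0 ?invr_gt0.
  rewrite -lee_fin /T /Rintegral fineK; last first.
    exact: (@integrable_fin_num _ _ _ leb X mX _ (integrable_tent _ _)).
  pose E' := B `&` `[s b + m / 4, t b - m / 4].
  have mE' : measurable E' by apply: measurableI => //; exact: measurable_itv.
  apply: (@le_trans _ _ (\int[leb]_(x in E') (m / 4)%:E)%E).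
    rewrite integral_cst// EFinM; apply: lee_wpmul2l; last exact: mass.
    by rewrite lee_fin divr_ge0// ltW.
  apply: (@le_trans _ _ (\int[leb]_(x in E') (tent (s b) (t b) x)%:E)%E).
    apply: ge0_le_integral => //.
    - by move=> x _; rewrite lee_fin divr_ge0// ltW.
    - by apply/measurable_EFinP; apply: measurable_funTS;
      exact: measurable_tent.
    - move=> x [_]; rewrite /= in_itv/= => xst; rewrite lee_fin.
      by apply: tent_ge => //; rewrite divr_ge0// ltW.
  apply: ge0_subset_integral => //.
  - by apply/measurable_EFinP; apply: measurable_funTS; exact: measurable_tent.
  - by move=> x Xx; rewrite lee_fin tent_ge0.
  - by move=> x [[]].
pose g b x := (T b)^-1 * tent (s b) (t b) x.
pose Kb b := (T b)^-1 * (1 + `|t b - s b|).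
have Kb0 b : 0 <= Kb b by rewrite mulr_ge0 ?invr_ge0 ?(ltW (T0 b))// addr_ge0.
exists (Kb true + Kb false), g; split.
- by rewrite addr_ge0.
- move=> b; split.
  + apply: measurable_funM => //; apply: measurable_funTS;
    exact: measurable_tent.
  + by move=> x _; rewrite mulr_ge0 ?tent_ge0// invr_ge0 ltW.
  + have ig : leb.-integrable X (EFin \o g b).
      have := @integrableZl _ _ _ leb X mX (T b)^-1 _ (integrable_tent (s b)
          (t b)).
      by apply: eq_integrable.
    rewrite -[LHS]fineK; last exact: (@integrable_fin_num _ _ _ leb X mX _ ig).
    congr EFin; rewrite -/(Rintegral _ _ _) RintegralZl// mulVf//.
    by rewrite gt_eqF.
- move=> b beta beta01; split.
    by move=> x _; rewrite mulr_ge0 ?tent_ge0// invr_ge0 ltW.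
  move=> x y _ _; rewrite /g -mulrBr normrM ger0_norm ?invr_ge0 ?(ltW (T0 b))//.
  apply: (@le_trans _ _ (Kb b * `|x - y| `^ beta)).
    rewrite /Kb -mulrA; apply: ler_wpM2l; first by rewrite invr_ge0 ltW.
    exact: tent_holder.
  by rewrite ler_wpM2r ?powR_ge0//; case: b; rewrite ?lerDl ?lerDr.
- move=> x _; have [xt|xt] := boolP (s true < x < t true).
    by rewrite /g (tent_out (disj true false x isT xt)) !mulr0.
  by rewrite /g (tent_out xt) mulr0 mul0r.
Qed.

(** The two densities are at distance 2 from each other. *)
Lemma separated_far (g : bool -> R -> R) (f : R -> R) :
  (forall b, prob_density X (g b)) ->
  (forall x, X x -> g true x * g false x = 0) ->
  prob_density X f -> exists b, (1 <= L1_dist X (g b) f)%E.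
Proof.
move=> dg sep df; have Ig b := prob_density_integrable (dg b).
have If := prob_density_integrable df.
have id b : leb.-integrable X (EFin \o (fun x => `|g b x - f x|)).
  have := @integrableB _ _ _ leb X mX _ _ (Ig b) If.
  by move=> /integrable_norm; apply: eq_integrable.
pose r b := \int[leb]_(x in X) `|g b x - f x|.
have rE b : L1_dist X (g b) f = (r b)%:E.
  by rewrite /r /Rintegral fineK//;
    exact: (@integrable_fin_num _ _ _ leb X mX _ (id b)).
have : 2 <= r true + r false.
  rewrite /r -RintegralD//.
  have -> : 2 = \int[leb]_(x in X) (g true x + g false x).
    by rewrite RintegralD// !prob_density_Rintegral.
  apply: le_Rintegral => //.
  - by have := @integrableD _ _ _ leb X mX _ _ (Ig true) (Ig false);
    apply: eq_integrable.
  - by have := @integrableD _ _ _ leb X mX _ _ (id true) (id false);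
    apply: eq_integrable.
  - move=> x Xx; have := sep x Xx; move=> /eqP; rewrite mulf_eq0.
    have [_ g1 _] := dg true; have [_ g0 _] := dg false.
    have := g1 x Xx; have := g0 x Xx.
    have := ler_norm (g true x - f x); have := ler_norm (g false x - f x).
    have := ler_norm (- (g true x - f x));
      have := ler_norm (- (g false x - f x)).
    by rewrite !normrN => ? ? ? ? ? ? /orP[]/eqP ?; lra.
move=> r2; have [r1|r1] := leP 1 (r true); [exists true|exists false];
  rewrite rE lee_fin//; lra.
Qed.

End separated.

(** * The bin width and the rate *)

Section rates.
Context (R : realType).
Implicit Types (M W beta alpha : R).

(** With signs on M / h bins of width h and height h^beta, the n outputs carry
    information W (M / h) (h^(beta + 1))^2 = W M h^(2 beta + 1) about the
    signs; the width is chosen to make it equal to one. *)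
Definition bin_width M W beta : R := (M * W) `^ (- (2 * beta + 1)^-1).

Lemma bin_width_gt0 M W beta : 0 < M -> 0 < W -> 0 < bin_width M W beta.
Proof. by move=> M0 W0; rewrite powR_gt0// mulr_gt0. Qed.

Lemma bin_width_balance M W beta : 0 < M -> 0 < W -> 0 < beta ->
  bin_width M W beta * (bin_width M W beta `^ beta) ^+ 2 * (M * W) = 1.
Proof.
move=> M0 W0 b0; have MW0 : 0 < M * W by rewrite mulr_gt0.
have h0 := bin_width_gt0 beta M0 W0.
have D0 : 2 * beta + 1 != 0 by rewrite gt_eqF// addr_gt0// mulr_gt0.
have pw (h : R) : 0 < h -> h * (h `^ beta) ^+ 2 = h `^ (2 * beta + 1).
  move=> hp; rewrite -powR_mulrn ?powR_ge0// -powRrM -[X in X * _]powRr1 ?ltW//.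
  rewrite -powRD; last by rewrite (gt_eqF hp) implybT.
  by congr (_ `^ _); ring.
rewrite pw//.
rewrite /bin_width -powRrM mulNr mulVf// powR_inv1 ?ltW// mulVf//.
by rewrite gt_eqF.
Qed.

Lemma rate_bin_width M W beta : 0 < M -> 0 < W -> 0 < beta ->
  M `^ ((beta + 1) / (2 * beta + 1)) * W `^ (- (beta / (2 * beta + 1))) =
  M * bin_width M W beta `^ beta.
Proof.
move=> M0 W0 b0.
have D0 : 2 * beta + 1 != 0 by rewrite gt_eqF// addr_gt0// mulr_gt0.
rewrite /bin_width -powRrM powRM ?ltW// mulrA; congr (_ * _).
  transitivity (M `^ 1 * M `^ (- (2 * beta + 1)^-1 * beta)).
    rewrite -powRD; last by rewrite (gt_eqF M0) implybT.
    by congr (_ `^ _); field.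
  by rewrite powRr1 ?ltW.
by congr (_ `^ _); field.
Qed.

Lemma expR_z_alpha alpha : 0 < alpha ->
  0 <= expR alpha - 1 <= z_alpha alpha.
Proof.
move=> a0; have e1 : 1 <= expR alpha by rewrite -expR0 ler_expR ltW.
rewrite subr_ge0 e1/= /z_alpha; apply: lerB; first by rewrite ler_expR; lra.
by rewrite -[leRHS]expR0 ler_expR; lra.
Qed.

End rates.

(** * The lower bound on the radius *)

Section radius.
Context (R : realType) (X : set R) (mX : measurable X).
Variables (gamma L L0 : R).
Hypotheses (gamma_gt0 : 0 < gamma) (gamma_lt1 : gamma < 1) (L0_lt : L0 < L).

(** Keeps rho below an absolute constant, as the mixture alternative
    requires. *)
Lemma density_mass_le (B : set R) (f : R -> R) (M C0 : R) :
  prob_density X f -> measurable B -> B `<=` X -> lebesgue_measure B = M%:E ->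
  0 <= C0 -> (forall x, B x -> C0 <= f x) -> M * C0 <= 1.
Proof.
move=> [mf f0 f1] mB BX MB C00 fB.
rewrite -lee_fin -f1 mulrC EFinM -MB -integral_cst//.
apply: (@le_trans _ _ (\int[lebesgue_measure]_(x in B) (f x)%:E)%E).
  apply: ge0_le_integral => //.
  - by apply/measurable_EFinP; exact: (measurable_funS mX).
by apply: ge0_subset_integral => //; exact/measurable_EFinP.
Qed.

Lemma density_support_gt0 (f : R -> R) :
  prob_density X f -> (0 < lebesgue_measure X)%E.
Proof.
move=> df; rewrite lt_neqAle measure_ge0 andbT; apply/eqP => X0.
have [_ _] := df; rewrite null_set_integral//.
  by move=> /eqP; rewrite eqe eq_sym oner_eq0.
by apply/measurable_EFinP; case: df.
Qed.

(** Mixture alternative if M <= 2 h, binned alternatives otherwise.  In both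
    cases W rho^2 <= c^2 M / h, by the equation defining h. *)
Lemma testing_risk_gt_rate (K : R) (g : bool -> R -> R) :
  0 <= K -> (forall b, prob_density X (g b)) ->
  (forall b beta, 0 < beta <= 1 -> holder_class X beta K (g b)) ->
  (forall x, X x -> g true x * g false x = 0) ->
  exists2 c : R, 0 < c &
  forall (beta alpha : R) (d : measure_display) (Z : measurableType d)
    (n : nat) (f : R -> R) (B : set R) (A M C0 rho : R),
  0 < beta <= 1 -> 0 < alpha < 1 -> (0 < n)%N ->
  prob_density X f -> holder_class X beta L0 f ->
  measurable B -> 0 <= A -> B `<=` `[- A, A] -> B `<=` X ->
  lebesgue_measure B = M%:E -> 0 < M -> 0 < C0 ->
  (forall x, B x -> C0 <= f x) -> 0 < rho ->
  rho <= c * Num.min (M * C0)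
    (M * bin_width M (n%:R * z_alpha alpha ^+ 2) beta `^ beta) ->
  (gamma%:E < testing_risk Z X beta L n alpha f rho)%E.
Proof.
move=> K0 dg hg sep; have [ga0 ga1 LL] := And3 gamma_gt0 gamma_lt1 L0_lt.
pose C := `|L0| + 2; pose eps := Num.min 1 ((L - L0) / C).
pose mix := (L - L0) / (K + `|L0| + 1); pose del := (1 - gamma) / 2.
have C2 : 2 <= C by rewrite /C lerDr.
have C_gt0 : 0 < C by lra.
have L0C : L0 <= C by rewrite /C; have := ler_norm L0; lra.
have eps0 : 0 < eps by rewrite lt_min ltr01 divr_gt0// subr_gt0.
have eps1 : eps <= 1 by rewrite ge_min lexx.
have epsL : L0 + eps * C <= L.
  have : eps <= (L - L0) / C by rewrite ge_min lexx orbT.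
  by rewrite ler_pdivlMr//; lra.
have den : 0 < K + `|L0| + 1 by rewrite ltr_wpDl// addr_ge0.
have mix0 : 0 < mix by rewrite divr_gt0// subr_gt0.
have del0 : 0 < del by rewrite divr_gt0// subr_gt0.
pose c := Num.min (Num.min 1 mix) (Num.min (eps / 16) (del / 3)).
have [e16 d3] : 0 < eps / 16 /\ 0 < del / 3 by split; lra.
have c0 : 0 < c by rewrite /c !lt_min ltr01 mix0 e16 d3.
have [c1 cmix ceps cdel] : [/\ c <= 1, c <= mix, c <= eps / 16 & c <= del / 3].
  by split; rewrite /c !ge_min lexx ?orbT.
exists c => // beta alpha d Z n f B A M C0 rho b01 /andP[a0 a1]
    n0 df hf mB A0 BA BX
  MB M0 C00 fB rho0.
have /andP[b0 b1] := b01.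
have /andP[ea0 eaz] := expR_z_alpha a0; set z := z_alpha alpha in eaz *.
set ea := expR alpha - 1 in ea0 eaz.
have z0 : 0 < z.
  apply: lt_le_trans eaz; rewrite subr_gt0 -[ltLHS]expR0 ltr_expR//.
pose W := n%:R * z ^+ 2.
have W0 : 0 < W by rewrite mulr_gt0 ?ltr0n// exprn_gt0.
rewrite -/W; set h := bin_width M W beta; set y := h `^ beta => rho_le.
have h0 : 0 < h by exact: bin_width_gt0.
have y0 : 0 < y by exact: powR_gt0.
have bal : h * y ^+ 2 * (M * W) = 1 by exact: bin_width_balance.
have MC1 : M * C0 <= 1 by apply: (density_mass_le df mB BX MB (ltW C00) fB).
have rho_MC : rho <= c * (M * C0).
  by apply: le_trans rho_le _; rewrite ler_wpM2l ?(ltW c0)// ge_min lexx.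
have rho_My : rho <= c * (M * y).
  by apply: le_trans rho_le _; rewrite ler_wpM2l ?(ltW c0)// ge_min lexx orbT.
have rho_c : rho <= c.
  by apply: le_trans rho_MC _; rewrite ler_piMr// ltW.
have alpha_ge0 := ltW a0.
(* The information is measured with z_alpha instead of e^alpha - 1. *)
have nW : n%:R * ea ^+ 2 <= W.
  by rewrite /W ler_wpM2l// ler_sqr ?nnegrE// (le_trans ea0 eaz).
have Wrho : W * rho ^+ 2 <= c ^+ 2 * (M / h).
  have -> : M / h = W * (M * y) ^+ 2.
    have hn : h != 0 by rewrite gt_eqF.
    apply: (mulfI hn); rewrite mulrCA divff// mulr1.
    by rewrite -[LHS]mulr1 -bal; ring.
  rewrite [leRHS]mulrCA -[c ^+ 2 * _]exprMn ler_wpM2l ?(ltW W0)//.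
  rewrite ler_sqr ?nnegrE ?(ltW rho0)// mulr_ge0 ?(ltW c0)//.
  by rewrite mulr_ge0 ?(ltW M0) ?(ltW y0).
have c2 : c ^+ 2 * 9 <= del ^+ 2.
  have -> : del ^+ 2 = (del / 3) ^+ 2 * 9 by field.
  by rewrite ler_pM2r// ler_sqr ?nnegrE ?(ltW c0)// (le_trans (ltW c0) cdel).
have delE : (1 - gamma) ^+ 2 / 4 = del ^+ 2 by rewrite /del; field.
have [wide|narrow] := leP M (2 * h).
  have [b far] := separated_far mX dg sep df.
  apply: (mixture_testing_risk Z mX alpha_ge0 ga1 ga0 df hf rho0 (dg b)
      (hg b beta b01) far).
  - exact: le_trans rho_c c1.
  - have : rho <= mix by exact: le_trans rho_c cmix.
    rewrite ler_pdivlMr// => rmix.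
    have : 0 <= rho * (`|L0| + L0).
      by apply: mulr_ge0; [exact: ltW|rewrite -lerBlDr sub0r -normrN ler_norm].
    nra.
  - rewrite delE -/ea.
    have : M / h <= 2 by rewrite ler_pdivrMr.
    have := sqr_ge0 c; have := sqr_ge0 rho => r2 cc Mh.
    have : n%:R * ea ^+ 2 * rho ^+ 2 <= W * rho ^+ 2 by rewrite ler_wpM2r.
    have : c ^+ 2 * (M / h) <= c ^+ 2 * 2 by rewrite ler_wpM2l.
    have -> : n%:R * (ea * (2 * rho)) ^+ 2 =
        4 * (n%:R * ea ^+ 2 * rho ^+ 2) by ring.
    lra.
(* Rounding up costs at most a factor 2 because u > 1. *)
pose u := M / (2 * h).
have u1 : 1 < u by rewrite /u ltr_pdivlMr ?mulr_gt0// mul1r.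
have [N N0 /andP[uN N2u]] : exists2 N, (0 < N)%N & u <= N%:R <= 2 * u.
  exists (Num.Def.trunc u).+1 => //.
  have /andP[t1 t2] := truncn_itv (ltW (lt_trans ltr01 u1)).
  by rewrite (ltW t2)/= -natr1; lra.
have NR : 0 < N%:R :> R by rewrite ltr0n.
have uh : M = 2 * h * u by rewrite /u mulrC divfK// gt_eqF// mulr_gt0.
pose m := M / (2 * N%:R).
have mh : h / 2 <= m.
  rewrite /m ler_pdivlMr ?mulr_gt0// uh.
  by have := ler_wpM2l (ltW h0) N2u; lra.
apply: (binned_testing_risk Z mX alpha_ge0 ga1 ga0 b01 df hf rho0 C2 L0C eps0 eps1 epsL
  mB A0 BA BX MB M0 C00 fB N0 (erefl : m = _)).
- have my : y / 8 <= (m / 4) `^ beta.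
    apply: (@le_trans _ _ ((h / 8) `^ beta)).
      rewrite powRM ?(ltW h0)// ?invr_ge0// ler_wpM2l ?(ltW y0)//.
      by apply: ger1_powR => //; rewrite invr_gt0 ltr0n invf_le1// ler1n.
    rewrite ge0_ler_powR ?nnegrE ?(ltW b0)//; try lra.
  rewrite minEle; case: ifP => _.
    apply: le_trans rho_MC _.
    have : c * (M * C0) <= eps / 16 * (M * C0).
      by rewrite ler_wpM2r// mulr_ge0 ?ltW.
    have : 0 <= eps * (M * C0) by rewrite !mulr_ge0 ?ltW.
    lra.
  apply: le_trans rho_My _.
  have : c * (M * y) <= eps / 16 * (M * y) by rewrite ler_wpM2r// mulr_ge0 ?ltW.
  have : eps * M * (y / 8) <= eps * M * (m / 4) `^ beta.
    by rewrite ler_wpM2l// mulr_ge0 ?ltW.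
  lra.
- rewrite delE -/ea ler_pdivrMr//.
  have Mh : M / h = 2 * u.
    by rewrite uh mulrC mulrA [h^-1 * _]mulrCA mulVf ?gt_eqF// mulr1.
  rewrite Mh in Wrho.
  have := sqr_ge0 c; have := sqr_ge0 rho => r2 cc.
  have : n%:R * ea ^+ 2 * rho ^+ 2 <= W * rho ^+ 2 by rewrite ler_wpM2r.
  have -> : n%:R * (ea * rho) ^+ 2 = n%:R * ea ^+ 2 * rho ^+ 2 by ring.
  have : c ^+ 2 * 9 * u <= del ^+ 2 * u by rewrite ler_wpM2r//; lra.
  have : del ^+ 2 * u <= del ^+ 2 * N%:R by rewrite ler_wpM2l// sqr_ge0.
  have : 0 <= c ^+ 2 * u by rewrite mulr_ge0//; lra.
  lra.
Qed.

End radius.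

(** If X carries no density there is nothing to prove; otherwise X has positive
    measure and the separated densities exist.  A value rho below the bound
    forces both |B| and the minimum of f0 over B to be positive. *)
Lemma testing_radius_lower_bound (R : realType) (X : set R) (mX : measurable X)
    (gamma L L0 : R) : 0 < gamma -> gamma < 1 -> L0 < L ->
  exists2 c : R, 0 < c &
    forall (beta alpha : R) (d : measure_display) (Z : measurableType d)
      (n : nat) (f0 : R -> R) (B : set R),
    0 < beta <= 1 -> 0 < alpha < 1 -> (0 < n)%N ->
    prob_density X f0 -> holder_class X beta L0 f0 ->
    compact B -> B `<=` X ->
    ((c * Num.min (vol B * min_on f0 B)
         (vol B `^ ((beta + 1) / (2 * beta + 1)) *
          (n%:R * z_alpha alpha ^+ 2) `^ (- (beta / (2 * beta + 1)))))%:E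
     <= testing_radius Z X beta L n alpha f0 gamma)%E.
Proof.
move=> ga0 ga1 LL.
have [[f1 df1]|/forallNP none] := pselect (exists f, prob_density X f);
  last first.
  by exists 1 => // beta alpha d Z n f0 B _ _ _ /none.
have [K [g [K0 dg hg sep]]] :=
  exists_separated_densities mX (density_support_gt0 mX df1).
have [c c0 risk] := testing_risk_gt_rate mX ga0 ga1 LL K0 dg hg sep.
exists c => // beta alpha d Z n f0 B b01 a01 n0 df hf cB BX.
apply: le_ereal_inf_tmp => _ [rho [rho0 risk_le] <-].
rewrite lee_fin leNgt; apply/negP => rho_lt.
have mB : measurable B by exact: compact_measurable.
have MB : lebesgue_measure B = (vol B)%:E.
  by rewrite /vol fineK// ge0_fin_numE// compact_finite_measure.
have f00 x : X x -> 0 <= f0 x by case: df => _ + _; exact.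
have fB x : B x -> min_on f0 B <= f0 x.
  move=> Bx; apply: ge_inf; last by exists x.
  by exists 0 => _ [y By <-]; exact/f00/BX.
have M0 : 0 <= vol B by rewrite fine_ge0.
have pos : 0 < vol B * min_on f0 B.
  have : 0 < c * Num.min (vol B * min_on f0 B)
      (vol B `^ ((beta + 1) / (2 * beta + 1)) *
       (n%:R * z_alpha alpha ^+ 2) `^ (- (beta / (2 * beta + 1)))).
    exact: lt_trans rho_lt.
  by rewrite pmulr_rgt0// lt_min => /andP[].
have Mpos : 0 < vol B.
  by rewrite lt_neqAle M0 andbT eq_sym; apply: contraTneq pos => ->;
    rewrite mul0r ltxx.
have Cpos : 0 < min_on f0 B by move: pos; rewrite pmulr_rgt0.
have [A [_ BA]] := compact_bounded cB.
have := risk beta alpha d Z n f0 B (`|A| + 1) (vol B) (min_on f0 B) rho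
  b01 a01 n0 df hf mB _ _ BX MB Mpos Cpos fB rho0.
have z0 : 0 < z_alpha alpha.
  case/andP: a01 => a0 _; have /andP[_] := expR_z_alpha a0.
  by apply: lt_le_trans; rewrite subr_gt0 -[ltLHS]expR0 ltr_expR.
have b0 : 0 < beta by case/andP: b01.
rewrite -rate_bin_width//; last by rewrite mulr_gt0 ?ltr0n// exprn_gt0.
move=> H; have : (gamma%:E < testing_risk Z X beta L n alpha f0 rho)%E.
  apply: H; last exact: ltW.
    by rewrite addr_ge0.
  move=> x Bx; rewrite /= in_itv/= -ler_norml.
  by apply: BA => //; rewrite ltr_pwDr// ler_norm.
by rewrite ltNge risk_le.
Qed.

Theorem theorem4p4 (R : realType) (X : set R) (mX : measurable X)
    (gamma L L0 : R) (gamma_gt0 : 0 < gamma) (gamma_lt1 : gamma < 1)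
    (L_gt0 : 0 < L) (L0_lt : L0 < L) :
  (exists2 c : R, 0 < c &
    forall (beta alpha : R) (d : measure_display) (Z : measurableType d)
      (n : nat) (f0 : R -> R) (B : set R),
    0 < beta <= 1 -> 0 < alpha < 1 -> (0 < n)%N ->
    prob_density X f0 -> holder_class X beta L0 f0 ->
    compact B -> B `<=` X ->
    ((c * Num.min (vol B * min_on f0 B)
         (vol B `^ ((beta + 1) / (2 * beta + 1)) *
          (n%:R * z_alpha alpha ^+ 2) `^ (- (beta / (2 * beta + 1)))))%:E
     <= testing_radius Z X beta L n alpha f0 gamma)%E)
  /\
  (forall C : R, 0 < C ->
   exists2 c : R, 0 < c &
    forall (beta alpha : R) (d : measure_display) (Z : measurableType d)
      (n : nat) (f0 : R -> R) (B : set R),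
    0 < beta <= 1 -> 0 < alpha < 1 -> (0 < n)%N ->
    prob_density X f0 -> holder_class X beta L0 f0 ->
    compact B -> B `<=` X ->
    C * (n%:R * z_alpha alpha ^+ 2) `^ (- (beta / (2 * beta + 1)))
      <= vol B `^ (beta / (2 * beta + 1)) * min_on f0 B ->
    ((c * (vol B `^ ((beta + 1) / (2 * beta + 1)) *
           (n%:R * z_alpha alpha ^+ 2) `^ (- (beta / (2 * beta + 1)))))%:E
     <= testing_radius Z X beta L n alpha f0 gamma)%E).
Proof.
have [c c0 main] := testing_radius_lower_bound mX gamma_gt0 gamma_lt1 L0_lt.
split; first by exists c.
move=> C C0; exists (c * Num.min 1 C).
  by rewrite mulr_gt0// lt_min ltr01.
move=> beta alpha d Z n f0 B b01 a01 n0 df hf cB BX large.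
apply: le_trans (main beta alpha d Z n f0 B b01 a01 n0 df hf cB BX).
rewrite lee_fin -mulrA ler_wpM2l ?(ltW c0)//.
have b0 : 0 < beta by case/andP: b01.
have D0 : 2 * beta + 1 != 0 by rewrite gt_eqF// addr_gt0// mulr_gt0.
set V := vol B in large *; set w := (_ * _) `^ _ in large *.
have V0 : 0 <= V by rewrite fine_ge0.
have w0 : 0 <= w by exact: powR_ge0.
set r := V `^ _ * w.
have r0 : 0 <= r by rewrite mulr_ge0// powR_ge0.
rewrite le_min; apply/andP; split; last first.
  by rewrite ler_piMl// ge_min lexx.
have VE : V = V `^ ((beta + 1) / (2 * beta + 1)) * V `^ (beta / (2 * beta + 1)).
  have e : (beta + 1) / (2 * beta + 1) + beta / (2 * beta + 1) = 1 by field.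
  have [->|Vn] := eqVneq V 0.
    rewrite (powR0 (x := (beta + 1) / _)) ?mul0r//.
    by rewrite mulf_neq0 ?invr_eq0// gt_eqF// addr_gt0.
  by rewrite -powRD ?e ?powRr1// Vn implybT.
apply: (@le_trans _ _ (C * r)).
  by rewrite ler_wpM2r// ge_min lexx orbT.
by rewrite [X in _ <= X * _]VE /r [leLHS]mulrCA -[leRHS]mulrA ler_wpM2l//
    powR_ge0.
Qed.
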